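(* Let $(S,\mathcal{B})$ be a standard Borel space and let $X=(X_1,X_2,\ldots)$ be a sequence of $S$-valued random variables on a probability space $(\Omega,\mathcal{A},P)$, with predictive distributions $\alpha_n$, $n\ge 0$. Suppose that, for each $f\in C_b(S)$, the sequence $\alpha_n(f)$ converges in probability as $n\to\infty$. Then $X$ is asymptotically exchangeable, that is, there is an exchangeable sequence $(Z_1,Z_2,\ldots)$ of $S$-valued random variables such that $(X_{n+1},X_{n+2},\ldots)\to(Z_1,Z_2,\ldots)$ in distribution as $n\to\infty$.
   Context: A standard Borel space $(S,\mathcal{B})$ here means that $S$ is a Borel subset of some Polish space and $\mathcal{B}$ is the Borel $\sigma$-field on $S$. $C_b(S)$ is the set of real bounded continuous functions on $S$. Set $\mathcal{F}_0=\{\emptyset,\Omega\}$ and $\mathcal{F}_n=\sigma(X_1,\ldots,X_n)$ for $n\ge 1$. A random probability measure on $\mathcal{B}$ is a map $\alpha$ on $\Omega\times\mathcal{B}$ such that $\alpha(\omega,\cdot)$ is a probability measure on $\mathcal{B}$ for each fixed $\omega\in\Omega$, and $\omega\mapsto\alpha(\omega,B)$ is $\mathcal{A}$-measurable for each fixed $B\in\mathcal{B}$. For a bounded measurable $f:S\to\mathbb{R}$, $\alpha(f)$ denotes the real random variable $\omega\mapsto\int f(x)\,\alpha(\omega,dx)$. The predictive distributions of $X$ are the random probability measures $\alpha_n(\cdot)=P(X_{n+1}\in\cdot\mid\mathcal{F}_n)$, $n\ge 0$ (regular conditional distributions), so that $\alpha_n(f)=E\{f(X_{n+1})\mid\mathcal{F}_n\}$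 a.s. for each bounded measurable $f$. Convergence in distribution of sequences is with respect to the product topology on $S^\infty$. The sequence $(Z_1,Z_2,\ldots)$ may be defined on any probability space. *)

(* Defs.v *)
From HB Require Import structures.
From mathcomp Require Import all_boot all_order all_fingroup all_algebra.
From mathcomp Require Import all_classical all_reals all_analysis.
From mathcomp Require Import measurable_realfun.
Set Implicit Arguments.
Unset Strict Implicit.
Unset Printing Implicit Defensive.
Import Order.TTheory GRing.Theory Num.Theory.
Import numFieldNormedType.Exports.
Local Open Scope classical_set_scope.
Local Open Scope ring_scope.

(* Sequences are indexed from 0: the i-th term
   here is the (i+1)-st term of a sequence numbered from 1. *)

Definition borelType (S : ptopologicalType) := g_sigma_algebraType (@open S).

Definition separable (T : topologicalType) : Prop :=
  exists2 D : set T, countable D & dense D.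

(* Completeness as in the library's [completeType], without its base point. *)
Definition polish_metric (R : realType) (T : metricType R) : Prop :=
  (forall F : set_system T, ProperFilter F -> cauchy F ->
     exists x : T, F --> x) /\
  separable T.

(* "S is a Borel subset of T, with the topology of T" is rendered by an
   injection e of S into T with Borel range such that the topology of S is the
   one induced by e; the literal case is e = set_val. *)
Definition standard_borel (R : realType) (S : topologicalType) : Prop :=
  exists (T : metricType R) (e : S -> T),
    [/\ polish_metric T, injective e,
        @open S = [set e @^-1` U | U in @open T]
      & <<s @open T >> (range e)].

Section Probability.
Context (R : realType) d (Omega : measurableType d) (P : probability Omega R).

(* Y is a version of the conditional probability P(E | G). *)
Definition is_cond_prob (G : set (set Omega)) (E : set Omega)
    (Y : Omega -> \bar R) : Prop :=
  (forall V : set (\bar R), measurable V -> G (Y @^-1` V)) /\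
  (forall A, G A -> (\int[P]_(w in A) Y w)%E = P (A `&` E)).

Definition cvg_in_probability (Y : nat -> Omega -> R) : Prop :=
  exists L : {RV P >-> R}, forall eps : R, 0 < eps ->
    P [set w | eps < `|Y n w - L w|] @[n --> \oo] --> 0%E.

Context (S : ptopologicalType).
Implicit Types X : nat -> {RV P >-> borelType S}.

(* The sigma-field generated by the first n terms; it is {set0, setT} when
   n = 0. *)
Definition past X (n : nat) : set (set Omega) :=
  g_sigma_preimage (fun i : 'I_n => X i : Omega -> borelType S).

(* A probability kernel from Omega to S is a random probability measure; here
   it is a regular version of P(X n \in . | past X n). *)
Definition is_predictive X (n : nat)
    (alpha : R.-pker Omega ~> borelType S) : Prop :=
  forall B : set (borelType S), measurable B ->
    is_cond_prob (past X n) (X n @^-1` B) (fun w => alpha w B).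

Definition exchangeable X : Prop :=
  forall (n : nat) (s : 'S_n) (C : set (n.-tuple (borelType S))),
    measurable C ->
    P [set w | C [tuple X (s i) w | i < n]] =
    P [set w | C [tuple X i w | i < n]].

End Probability.

(* Weak convergence of the laws on S^oo, with its product topology. *)
Definition cvg_in_distribution (R : realType) (S : ptopologicalType)
    d (Omega : measurableType d) (P : probability Omega R)
    (Y : nat -> Omega -> {ptws nat -> S})
    d' (Omega' : measurableType d') (Q : probability Omega' R)
    (Z : Omega' -> {ptws nat -> S}) : Prop :=
  forall g : {ptws nat -> S} -> R, continuous g -> bounded_fun g ->
    'E_P[g \o Y n]%E @[n --> \oo] --> 'E_Q[g \o Z]%E.

Definition asymptotically_exchangeable (R : realType) (S : ptopologicalType)
    d (Omega : measurableType d) (P : probability Omega R)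
    (X : nat -> {RV P >-> borelType S}) : Prop :=
  exists (d' : measure_display) (Omega' : measurableType d')
    (Q : probability Omega' R) (Z : nat -> {RV Q >-> borelType S}),
    exchangeable Z /\
    cvg_in_distribution P (fun n w i => X (n + i)%N w)
      Q (fun w i => Z i w).

(* Main.v *)
Require Import Defs.
From HB Require Import structures.
From mathcomp Require Import all_boot all_order all_fingroup all_algebra.
From mathcomp Require Import all_classical all_reals all_analysis.
From mathcomp Require Import measurable_realfun.
From mathcomp Require Import ring lra.
Set Implicit Arguments.
Unset Strict Implicit.
Unset Printing Implicit Defensive.
Import Order.TTheory GRing.Theory Num.Theory.
Import numFieldNormedType.Exports.
Local Open Scope classical_set_scope.
Local Open Scope ring_scope.

(** The L1-Cauchy predictive means [alpha_n(f)] allow one to replace, one factor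
    at a time from the last to the first, each [f_i(X_(n+i))] by
    [alpha_(n+i)(f_i)] (conditioning) and then by [alpha_n(f_i)], so that
    [E \prod_i f_i(X_(n+i))] has the same limit as [E \prod_i alpha_n(f_i)]. The
    latter does not see the order of the factors, whence exchangeability.

    To produce a limit law we use Alexandrov's theorem: if the integrals of every
    bounded continuous function converge along a sequence of laws, then the limit
    functional is sigma-smooth (a gliding hump argument) and is therefore the
    integral of a probability measure. It is used twice. On [S] it gives a limit
    of the laws of the [X_n], which is tight because [S] is a Borel subset of a
    Polish space. Through Tychonoff and a product partition of unity, tightness
    upgrades the convergence of products to that of [E g(X_n, X_(n+1), ...)] for
    every bounded continuous [g] on the sequence space, where the theorem then
    gives the law of [Z], realised by the coordinates. *)

(** * Means of bounded measurable functions *)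

Section BoundedMeasurable.
Context (R : realType) d (T : measurableType d).
Implicit Types (f g : T -> R).

(** Working from the last factor down is forced by measurability: when [f_i(X_(n+i))] is conditioned
    on its past, the earlier factors are functions of that past, and the later ones have already
    become functions of the past of [n]. Convergence in probability enters only through the Cauchy
    property in mean, so the limits of the [alpha_n(f)] are never assembled into a random measure.
    The obstacle is that convergent means of products of functions of single coordinates do not yet
    give a law, since [S] is not compact and mass might escape. The one-factor case, fed to
    Alexandrov's theorem, excludes this: the same law on [S] is the limit for every coordinate
    [X_(n+i)], so a single tight law controls them all. Test functions take values in [0, 1], which
    keeps products in the class. Countably many continuous functions whose cozero sets form a base
    do the work of a metric on the sequence space. *)

Definition bounded_measurable f :=
  measurable_fun setT f /\ exists M : R, forall x, `|f x| <= M.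

Lemma bounded_measurable_cst (c : R) : bounded_measurable (fun=> c).
Proof. by split; [exact: measurable_cst|exists `|c|]. Qed.

Lemma bounded_measurableD f g : bounded_measurable f -> bounded_measurable g ->
  bounded_measurable (fun x => f x + g x).
Proof.
move=> [mf [M fM]] [mg [N gN]]; split; first exact: measurable_funD.
by exists (M + N) => x; rewrite (le_trans (ler_normD _ _))// lerD.
Qed.

Lemma bounded_measurableM f g : bounded_measurable f -> bounded_measurable g ->
  bounded_measurable (fun x => f x * g x).
Proof.
move=> [mf [M fM]] [mg [N gN]]; split; first exact: measurable_funM.
by exists (M * N) => x; rewrite normrM ler_pM.
Qed.

Lemma bounded_measurableB f g : bounded_measurable f -> bounded_measurable g ->
  bounded_measurable (fun x => f x - g x).
Proof.
move=> [mf [M fM]] [mg [N gN]]; split; first exact: measurable_funB.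
by exists (M + N) => x; rewrite (le_trans (ler_normB _ _))// lerD.
Qed.

Lemma bounded_measurable_norm f : bounded_measurable f ->
  bounded_measurable (fun x => `|f x|).
Proof.
move=> [mf [M fM]]; split; first exact: measurableT_comp.
by exists M => x; rewrite normr_id.
Qed.

Lemma bounded_measurable_sum I (s : seq I) (P : pred I) (F : I -> T -> R) :
  (forall i, P i -> bounded_measurable (F i)) ->
  bounded_measurable (fun x => \sum_(i <- s | P i) F i x).
Proof.
move=> bF.
rewrite (_ : (fun x => _) = \big[(fun f g x => f x + g x)/(fun=> 0)]_(i <- s | P i) F i).
  elim/big_ind : _ => //; first exact: bounded_measurable_cst.
  exact: bounded_measurableD.
by apply/funext => x; elim/big_rec2 : _ => // i f r _ ->.
Qed.

Lemma bounded_measurable_prod I (s : seq I) (P : pred I) (F : I -> T -> R) :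
  (forall i, P i -> bounded_measurable (F i)) ->
  bounded_measurable (fun x => \prod_(i <- s | P i) F i x).
Proof.
move=> bF.
rewrite (_ : (fun x => _) = \big[(fun f g x => f x * g x)/(fun=> 1)]_(i <- s | P i) F i).
  elim/big_ind : _ => //; first exact: bounded_measurable_cst.
  exact: bounded_measurableM.
by apply/funext => x; elim/big_rec2 : _ => // i f r _ ->.
Qed.

Lemma bounded_measurable_indic (A : set T) : measurable A ->
  bounded_measurable (\1_A : T -> R).
Proof.
move=> mA; split; first exact: measurable_indic.
by exists 1 => x; rewrite ger0_norm indicE ?ler0n// lern1 leq_b1.
Qed.

Variable mu : probability T R.

Lemma bounded_measurable_integrable f : bounded_measurable f ->
  mu.-integrable setT (EFin \o f).
Proof.
move=> [mf [M fM]]; apply: measurable_bounded_integrable => //.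
  exact: fin_num_fun_lty.
exists M; split; rewrite ?num_real// => N MN x _.
by rewrite /= (le_trans (fM x))// ltW.
Qed.

Lemma mean_cst (c : R) : \int[mu]_x c = c.
Proof.
have mu1 : fine (mu setT) = 1 by rewrite probability_setT.
by rewrite Rintegral_cst// mu1 mulr1.
Qed.

Lemma EFin_mean f : bounded_measurable f ->
  (\int[mu]_x f x)%:E = (\int[mu]_x (f x)%:E)%E.
Proof.
by move=> bf; rewrite /Rintegral fineK// integrable_fin_num//; exact: bounded_measurable_integrable.
Qed.

Lemma meanD f g : bounded_measurable f -> bounded_measurable g ->
  \int[mu]_x (f x + g x) = \int[mu]_x f x + \int[mu]_x g x.
Proof. by move=> bf bg; rewrite RintegralD//; exact: bounded_measurable_integrable. Qed.

Lemma meanB f g : bounded_measurable f -> bounded_measurable g ->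
  \int[mu]_x (f x - g x) = \int[mu]_x f x - \int[mu]_x g x.
Proof. by move=> bf bg; rewrite RintegralB//; exact: bounded_measurable_integrable. Qed.

Lemma meanZ f (c : R) : bounded_measurable f ->
  \int[mu]_x (c * f x) = c * \int[mu]_x f x.
Proof. by move=> bf; rewrite RintegralZl//; exact: bounded_measurable_integrable. Qed.

Lemma mean_sum I (s : seq I) (P : pred I) (F : I -> T -> R) :
  (forall i, P i -> bounded_measurable (F i)) ->
  \int[mu]_x (\sum_(i <- s | P i) F i x) = \sum_(i <- s | P i) \int[mu]_x F i x.
Proof.
move=> bF; elim: s => [|i s IHs].
  by rewrite big_nil -[RHS]mean_cst; apply: eq_Rintegral => x _; rewrite big_nil.
rewrite big_cons; case: ifPn => Pi.
  rewrite -IHs -meanD; [|exact: bF|exact: bounded_measurable_sum].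
  by apply: eq_Rintegral => x _; rewrite big_cons Pi.
by rewrite -IHs; apply: eq_Rintegral => x _; rewrite big_cons (negPf Pi).
Qed.

Lemma le_mean f g : bounded_measurable f -> bounded_measurable g ->
  (forall x, f x <= g x) -> \int[mu]_x f x <= \int[mu]_x g x.
Proof.
move=> bf bg fg; apply: le_Rintegral => //; exact: bounded_measurable_integrable.
Qed.

Lemma norm_mean_le f : bounded_measurable f ->
  `|\int[mu]_x f x| <= \int[mu]_x `|f x|.
Proof. by move=> bf; apply: le_normr_Rintegral => //; exact: bounded_measurable_integrable. Qed.

Lemma mean_indic (A : set T) : measurable A ->
  \int[mu]_x \1_A x = fine (mu A).
Proof. by move=> mA; rewrite /Rintegral integral_indic// setIT. Qed.

Lemma mean_cvg (F : nat -> T -> R) (f : T -> R) (M : R) :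
  (forall n, measurable_fun setT (F n)) -> (forall n x, `|F n x| <= M) ->
  (forall x, F n x @[n --> \oo] --> f x) ->
  \int[mu]_x F n x @[n --> \oo] --> \int[mu]_x f x.
Proof.
move=> mF FM Ff.
have mf : measurable_fun setT f.
  by apply: (measurable_fun_cvg mF) => x _; exact: Ff.
have fM x : `|f x| <= M.
  by apply: (cvgr_to_le (cvg_norm (Ff x))); exact: nearW.
apply: fine_cvg; rewrite EFin_mean; last by split => //; exists M.
apply: (@dominated_cvg _ _ _ _ _ _ _ _ (fun=> M%:E)) => //.
- by move=> n; exact/measurable_EFinP.
- by move=> x _; apply: cvg_EFin; [exact: nearW|exact: Ff].
- apply: (bounded_measurable_integrable (bounded_measurable_cst M)).
- by move=> n x _; rewrite lee_fin.
Qed.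

End BoundedMeasurable.

Section Pushforward.
Context (R : realType) d d' (T : measurableType d) (T' : measurableType d').

Lemma bounded_measurable_comp (f : T' -> R) (h : T -> T') :
  measurable_fun setT h -> bounded_measurable f -> bounded_measurable (f \o h).
Proof.
by move=> mh [mf [M fM]]; split; [exact: measurableT_comp|exists M => x /=].
Qed.

Lemma mean_distribution (mu : probability T R) (h : {RV mu >-> T'})
    (f : T' -> R) : bounded_measurable f ->
  \int[distribution mu h]_y f y = \int[mu]_x f (h x).
Proof.
move=> bf; rewrite /Rintegral integral_distribution//; first exact/measurable_EFinP/bf.1.
apply: (@bounded_measurable_integrable _ _ _ mu (f \o h)).
exact: bounded_measurable_comp.
Qed.

End Pushforward.

(** * Alexandrov's theorem on weakly convergent sequences of laws *)

Section Continuous01.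
Context (R : realType) (V : topologicalType).
Implicit Types f g : V -> R.

(** The range [0, 1] makes the class stable under products and under [1 - f]. Every bounded
    continuous function is an affine image of a member. *)
Definition continuous01 f := continuous f /\ forall x, 0 <= f x <= 1.

Lemma continuous01_cst (c : R) : 0 <= c <= 1 -> continuous01 (fun=> c).
Proof. by move=> c01; split => // x; exact: cvg_cst. Qed.

Lemma continuous01_min f g : continuous f -> continuous01 g -> (forall x, 0 <= f x) ->
  continuous01 (fun x => Num.min (f x) (g x)).
Proof.
move=> cf [cg g01] f0; split => x; first exact: continuous_min (cf x) (cg x).
have /andP[g0 g1] := g01 x.
by rewrite le_min f0 g0/= ge_min g1 orbT.
Qed.

Lemma continuous01_compl f : continuous01 f -> continuous01 (fun x => 1 - f x).
Proof.
move=> [cf f01]; split => x; first by apply: cvgB; [exact: cvg_cst|exact: cf].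
by have := f01 x; lra.
Qed.

Lemma continuous_bigsum I (s : seq I) (P : pred I) (F : I -> V -> R) :
  (forall i, P i -> continuous (F i)) ->
  continuous (fun x => \sum_(i <- s | P i) F i x).
Proof. by move=> cF; apply: (@continuous_big R I +%R 0 P (@add_continuous R) V s F). Qed.

Lemma continuous_bigprod I (s : seq I) (P : pred I) (F : I -> V -> R) :
  (forall i, P i -> continuous (F i)) ->
  continuous (fun x => \prod_(i <- s | P i) F i x).
Proof. by move=> cF; apply: (@continuous_big R I *%R 1 P (@mul_continuous R) V s F). Qed.

(** The form in which metrizability is used: indicators of open sets are increasing limits of
    continuous functions. The value 1 is attained, not only approached, so by monotonicity [h n x]
    is eventually constant at each point. *)
Definition open_exhaustible := forall G : set V, open G ->
  exists h : nat -> V -> R, [/\ forall n, continuous01 (h n),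
    forall x, {homo h ^~ x : m n / (m <= n)%N >-> m <= n},
    forall n x, ~ G x -> h n x = 0
    & forall x, G x -> exists n, h n x = 1].

End Continuous01.
Arguments open_exhaustible : clear implicits.

Section BorelContinuous.
Context (R : realType) (V : ptopologicalType).

Lemma borel_continuous (f : V -> R) : continuous f ->
  measurable_fun setT (f : borelType V -> R).
Proof.
move=> /continuousP cf; apply: (measurability _ (RGenOpens.measurableE R)).
move=> _ [_ [a [b ->] <-]]; rewrite setTI; apply: sub_sigma_algebra.
exact/cf/interval_open.
Qed.

Lemma bounded_measurable_continuous (f : V -> R) (M : R) : continuous f ->
  (forall x, `|f x| <= M) -> bounded_measurable (f : borelType V -> R).
Proof. by move=> cf fM; split; [exact: borel_continuous|exists M]. Qed.

Lemma bounded_measurable_continuous01 (f : V -> R) : continuous01 f ->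
  bounded_measurable (f : borelType V -> R).
Proof.
move=> [cf f01]; apply: (@bounded_measurable_continuous _ 1) => // x.
by have /andP[? ?] := f01 x; rewrite ger0_norm.
Qed.

End BorelContinuous.

Section WeakLimit.
Context (R : realType) (V : ptopologicalType)
  (mu : nat -> probability (borelType V) R).
Hypothesis mu_cvg : forall f : V -> R, continuous01 f ->
  cvgn (fun n => \int[mu n]_x f x).

Let bm := @bounded_measurable_continuous01 R V.

Definition limit_functional (f : V -> R) : R := limn (fun n => \int[mu n]_x f x).
Local Notation L := limit_functional.

Lemma limit_functional_cvg f : continuous01 f -> \int[mu n]_x f x @[n --> \oo] --> L f.
Proof. by move=> /mu_cvg. Qed.

(** Sums and multiples may leave [0, 1], where convergence of the means is not assumed. The
    inequality is therefore passed to the limit term by term, and [L] is only ever applied to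
    members of the class. *)
Lemma limit_functional_sum (I : Type) (s : seq I) (F : I -> V -> R) (f : V -> R) (c : R) :
  continuous01 f -> (forall i, continuous01 (F i)) ->
  (forall x, c * f x <= \sum_(i <- s) F i x) -> c * L f <= \sum_(i <- s) L (F i).
Proof.
move=> cf cF fF.
apply: (@ler_cvg_to nat \oo _ R (fun n => c * \int[mu n]_x f x)
  (fun n => \sum_(i <- s) \int[mu n]_x F i x)).
- by apply: cvgM; [exact: cvg_cst|exact: limit_functional_cvg].
- by apply: cvg_big => [|i _]; [exact: add_continuous|exact: limit_functional_cvg].
- apply: nearW => n; rewrite -mean_sum; last by move=> i _; exact: bm.
  rewrite -meanZ; last exact: bm.
  apply: le_mean => //.
  + exact: bounded_measurableM (bounded_measurable_cst _ _) (bm cf).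
  + by apply: bounded_measurable_sum => i _; exact: bm.
Qed.

Lemma limit_functional_superadd f g h : continuous01 f -> continuous01 g ->
  continuous01 h -> (forall x, f x + g x <= h x) -> L f + L g <= L h.
Proof.
move=> cf cg ch fgh.
apply: (@ler_cvg_to nat \oo _ R (fun n => \int[mu n]_x f x + \int[mu n]_x g x)
  (fun n => \int[mu n]_x h x)).
- by apply: cvgD; exact: limit_functional_cvg.
- exact: limit_functional_cvg.
- apply: nearW => n; rewrite -meanD; [|exact: bm..].
  by apply: le_mean => //; [apply: bounded_measurableD|]; exact: bm.
Qed.

Lemma limit_functional_le f g : continuous01 f -> continuous01 g ->
  (forall x, f x <= g x) -> L f <= L g.
Proof.
move=> cf cg fg; have := @limit_functional_sum _ [:: tt] (fun=> g) f 1 cf (fun=> cg).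
by rewrite mul1r big_seq1; apply => x; rewrite mul1r big_seq1.
Qed.

Lemma limit_functional_subadd f g h : continuous01 f -> continuous01 g ->
  continuous01 h -> (forall x, h x <= f x + g x) -> L h <= L f + L g.
Proof.
move=> cf cg ch hfg.
have := @limit_functional_sum _ [:: true; false] (fun b => if b then f else g) h 1 ch.
rewrite mul1r !big_cons big_nil addr0; apply => [[]//|x].
by rewrite mul1r !big_cons big_nil addr0.
Qed.

Lemma limit_functional_cst (c : R) : L (fun=> c) = c.
Proof.
rewrite /limit_functional; under eq_fun do rewrite mean_cst.
exact: lim_cst.
Qed.

Lemma limit_functional01 f : continuous01 f -> 0 <= L f <= 1.
Proof.
move=> cf; rewrite -{1}(limit_functional_cst 0) -(limit_functional_cst 1).
have [? f01] := cf.
by apply/andP; split; apply: limit_functional_le => //;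
  try (by apply: continuous01_cst; lra); move=> x; have := f01 x; lra.
Qed.

(* Gliding hump: if [L (F k)] stayed above [e], one could interleave indices
   [K j] of [F] and [nj] of [mu] so that the block sum
   [\sum_j (F (K (2j)) - F (K (2j+1)))], which is continuous because its tails
   are dominated by [F (K (2j))], has integrals oscillating along [mu]. *)
Lemma limit_functional_smooth (F : nat -> V -> R) :
  (forall k, continuous01 (F k)) -> (forall k x, F k.+1 x <= F k x) ->
  (forall x, F k x @[k --> \oo] --> 0) ->
  forall e, 0 < e -> exists k, L (F k) < e.
Proof.
move=> cF dF F0 e e0; apply: contrapT => /forallNP LF.
have {}LF k : e <= L (F k) by rewrite leNgt; apply/negP/LF.
have hF x : {homo F ^~ x : m n / (m <= n)%N >-> n <= m}.
  by apply/nonincreasing_seqP => n; exact: dF.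
have cvLF : cvgn (fun k => L (F k)).
  apply: nonincreasing_is_cvgn.
    by move=> m n mn; apply: limit_functional_le => // x; exact: hF.
  by exists 0 => _ [k _ <-]; rewrite (le_trans (ltW e0)).
have e8 : 0 < e / 8 by rewrite divr_gt0.
(* Past [K0] the values [L (F k)] are almost constant; this is what keeps the integrals at odd times
   small. *)
have [K0 K0e] : exists K0, forall k, (K0 <= k)%N -> L (F K0) - L (F k) <= e / 8.
  have /cvgrPdist_le/(_ _ e8)[K0 _ hK0] := cvLF.
  exists K0 => k K0k; rewrite (@le_trans _ _ (L (F K0) - limn (fun k => L (F k))))//.
    rewrite lerB//; apply: (@nonincreasing_cvgn_ge _ (fun k => L (F k))) => //.
    by move=> m n mn; apply: limit_functional_le => // x; exact: hF.
  have := hK0 K0 (leqnn _); rewrite distrC; apply: le_trans; exact: ler_norm.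
have /choice[N hN] : forall jk : nat * nat, exists n,
    [/\ (jk.1 <= n)%N, `|\int[mu n]_x F jk.2 x - L (F jk.2)| <= e / 8
      & `|\int[mu n]_x F K0 x - L (F K0)| <= e / 8].
  move=> -[j k] /=.
  have /cvgrPdist_le/(_ _ e8)[n1 _ hn1] := limit_functional_cvg (cF k).
  have /cvgrPdist_le/(_ _ e8)[n2 _ hn2] := limit_functional_cvg (cF K0).
  exists (maxn j (maxn n1 n2)); split; first exact: leq_maxl.
    by rewrite distrC; apply: hn1; rewrite /= !leq_max leqnn !orbT.
  by rewrite distrC; apply: hn2; rewrite /= !leq_max leqnn !orbT.
have /choice[M hM] : forall nk : nat * nat, exists k,
    (nk.2 < k)%N /\ \int[mu nk.1]_x F k x <= e / 8.
  move=> -[n k] /=.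
  have : \int[mu n]_x F k x @[k --> \oo] --> \int[mu n]_x 0.
    apply: (@mean_cvg _ _ _ (mu n) F (fun=> 0) 1) => //.
      by move=> i; have [] := bm (cF i).
    by move=> i x; have [_ /(_ x)/andP[? ?]] := cF i; rewrite ger0_norm.
  rewrite mean_cst => /cvgrPdist_le/(_ _ e8)[k' _ hk'].
  exists (maxn k.+1 k'); split; first exact: leq_maxl.
  have := hk' (maxn k.+1 k') (leq_maxr _ _); rewrite distrC subr0.
  by apply: le_trans; exact: ler_norm.
(* The two choices alternate: [n j] is late enough for the means of [F (K j)] and [F K0] to be near
   their limits, then [K j.+1] is far enough for [F (K j.+1)] to be negligible under [mu (n j)]. *)
pose K := fix K j := if j is j'.+1 then M (N (j', K j'), K j') else K0.
pose n j := N (j, K j).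
have KS1 j : (K j < K j.+1)%N by have [] := hM (n j, K j).
have KS j : (K j <= K j.+1)%N := ltnW (KS1 j).
have jK j : (j <= K j)%N by elim: j => // j /leq_ltn_trans; apply.
have KK0 j : (K0 <= K j)%N by elim: j => // j /leq_trans; apply.
have nj j : (j <= n j)%N by have [] := hN (j, K j).
have nK j : `|\int[mu (n j)]_x F (K j) x - L (F (K j))| <= e / 8 by have [] := hN (j, K j).
have nK0 j : `|\int[mu (n j)]_x F K0 x - L (F K0)| <= e / 8 by have [] := hN (j, K j).
have nKS j : \int[mu (n j)]_x F (K j.+1) x <= e / 8 by have [] := hM (n j, K j).
pose S J x := \sum_(0 <= j < J) (F (K j.*2) x - F (K j.*2.+1) x).
have S_S J x : S J.+1 x = S J x + (F (K J.*2) x - F (K J.*2.+1) x).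
  by rewrite /S big_nat_recr.
have S0 x : S 0%N x = 0 by rewrite /S big_geq.
have SJp x J p : S (J + p)%N x - S J x <= F (K J.*2) x - F (K (J + p).*2) x.
  elim: p => [|p IHp]; first by rewrite addn0 !subrr.
  rewrite addnS S_S doubleS.
  have := hF x _ _ (KS (J + p).*2.+1); lra.
have hS x : {homo S ^~ x : m n / (m <= n)%N >-> m <= n}.
  apply/nondecreasing_seqP => J; rewrite S_S lerDl subr_ge0.
  exact: hF.
have F01 k x : 0 <= F k x <= 1 by have [_] := cF k.
have cS x : cvgn (S ^~ x).
  apply: nondecreasing_is_cvgn; first exact: hS.
  exists 1 => _ [J _ <-]; have := SJp x 0%N J.
  rewrite add0n S0.
  have := F01 (K 0%N) x; have := F01 (K J.*2) x; rewrite /= => ? ? ?; lra.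
pose Fs x := limn (S ^~ x).
have SFs J x : S J x <= Fs x by exact: (@nondecreasing_cvgn_le _ (S ^~ x)).
have FsS J x : Fs x <= S J x + F (K J.*2) x.
  apply: limr_le; first exact: cS.
  exists J => // J' /= JJ'; have := SJp x J (J' - J)%N.
  rewrite subnKC//; have := F01 (K J'.*2) x; lra.
have cFs : continuous01 Fs.
  split; last first.
    move=> x; have := SFs 0%N x; have := FsS 0%N x; rewrite S0.
    have := F01 (K 0%N) x; rewrite /=; lra.
  move=> x; apply/cvgrPdist_le => d d0.
  have d3 : 0 < d / 3 by rewrite divr_gt0.
  have /cvgrPdist_lt/(_ _ d3)[k _ hk] := F0 x.
  have [J kJ] : exists J, F (K J.*2) x < d / 3.
    have kJ : (k <= K k.*2)%N by rewrite (leq_trans _ (jK _))// -addnn leq_addr.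
    exists k; have := hk _ kJ; rewrite /= sub0r normrN.
    exact/le_lt_trans/ler_norm.
  have cSJ : {for x, continuous (S J)}.
    apply: (@continuous_bigsum _ _ _ _ _ (fun j x => F (K j.*2) x - F (K j.*2.+1) x)).
    move=> j _ y; apply: cvgB; [exact: (cF _).1|exact: (cF _).1].
  have cFJ : {for x, continuous (F (K J.*2))} by exact: (cF _).1.
  have /cvgrPdist_lt/(_ _ d3) nS := cSJ.
  have /cvgr_lt/(_ _ kJ) nF := cFJ.
  near=> y.
  have h1 : `|S J x - S J y| < d / 3 by near: y.
  have h2 : F (K J.*2) y < d / 3 by near: y.
  have := SFs J x; have := SFs J y; have := FsS J x; have := FsS J y.
  move: h1; rewrite ltr_norml ler_norml; lra.
have bFs := bm cFs.
have even_ge i : e * 6 / 8 <= \int[mu (n i.*2)]_x Fs x.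
  have := nK i.*2; have := nKS i.*2; have := LF (K i.*2).
  have : \int[mu (n i.*2)]_x (F (K i.*2) x - F (K i.*2.+1) x) <= \int[mu (n i.*2)]_x Fs x.
    apply: le_mean => //; first by apply: bounded_measurableB; exact: bm.
    move=> x; have := SFs i.+1 x; rewrite S_S.
    have := hS x _ _ (leq0n i); rewrite /= S0; lra.
  rewrite meanB; [|exact: bm..].
  rewrite ler_norml; lra.
have odd_le i : \int[mu (n i.*2.+1)]_x Fs x <= e * 4 / 8.
  have := nK i.*2.+1; have := nK0 i.*2.+1; have := nKS i.*2.+1; have := K0e _ (KK0 i.*2.+1).
  have : \int[mu (n i.*2.+1)]_x (Fs x + F (K i.*2.+1) x) <=
         \int[mu (n i.*2.+1)]_x (F K0 x + F (K i.*2.+2) x).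
    apply: le_mean => //; [by apply: bounded_measurableD => //; exact: bm..|].
    move=> x; have := FsS i.+1 x; rewrite doubleS S_S.
    have := SJp x 0%N i; rewrite add0n S0 subr0; lra.
  rewrite !meanD//; [|exact: bm..].
  rewrite !ler_norml; lra.
(* Two integrals at distance less than [e / 8] from a common limit differ by less than [2 * e / 8],
   which is the gap between the even and odd bounds. *)
have /cvgrPdist_lt/(_ _ e8)[n0 _ hn0] := limit_functional_cvg cFs.
have := hn0 (n n0.*2); have := hn0 (n n0.*2.+1).
have := even_ge n0; have := odd_le n0.
have n1 : (n0 <= n n0.*2)%N by rewrite (leq_trans _ (nj _))// -addnn leq_addr.
have n2 : (n0 <= n n0.*2.+1)%N by rewrite (leq_trans _ (nj _))// -addnn leqW// leq_addr.
move=> h1 h2 /(_ n2) + /(_ n1); rewrite !ltr_norml; lra.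
Unshelve. all: by end_near.
Qed.

End WeakLimit.

(** * Construction of the limit measure from the limit functional *)

Section OuterMass.
Context (R : realType) (V : ptopologicalType)
  (mu : nat -> probability (borelType V) R).
Hypothesis mu_cvg : forall f : V -> R, continuous01 f ->
  cvgn (fun n => \int[mu n]_x f x).
Hypothesis V_exh : open_exhaustible R V.

Local Notation L := (limit_functional mu).

(** The values of the Riesz construction: a supremum over test functions below the indicator for
    open sets, then an infimum over open supersets. Test functions vanish outside [G] instead of
    having compact support, since no local compactness is at hand. *)
Definition open_mass (G : set V) : \bar R := ereal_sup
  [set (L f)%:E | f in [set f | continuous01 f /\ forall x, ~ G x -> f x = 0]].

Definition outer_mass (B : set V) : \bar R := ereal_inf
  [set open_mass G | G in [set G | open G /\ B `<=` G]].

Let L01 := limit_functional01 mu_cvg.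

Lemma le_limit_open_mass f G : continuous01 f -> (forall x, ~ G x -> f x = 0) ->
  ((L f)%:E <= open_mass G)%E.
Proof. by move=> cf fG; apply: ereal_sup_ubound; exists f. Qed.

Lemma open_mass_ge0 G : (0 <= open_mass G)%E.
Proof.
rewrite (_ : 0%E = (L (fun=> 0))%:E); last by rewrite limit_functional_cst.
apply: le_limit_open_mass => //.
by apply: continuous01_cst; rewrite lexx ler01.
Qed.

Lemma open_mass_le1 G : (open_mass G <= 1)%E.
Proof.
by apply: ge_ereal_sup => _ [f [cf _] <-]; rewrite lee_fin; have /andP[] := L01 cf.
Qed.

Lemma open_mass_fin_num G : open_mass G \is a fin_num.
Proof.
rewrite ge0_fin_numE ?open_mass_ge0//.
by rewrite (le_lt_trans (open_mass_le1 G))// ltry.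
Qed.

Lemma le_open_mass G H : G `<=` H -> (open_mass G <= open_mass H)%E.
Proof.
move=> GH; apply: ge_ereal_sup => _ [f [cf fG] <-].
by apply: le_limit_open_mass => // x Hx; apply: fG => /GH.
Qed.

(** This is where sigma-smoothness enters. The first [K] exhausting functions at stage [K], summed
    and capped by [f], equal [f] at each point from some [K] on, so [L] of the remainder is
    eventually small. The capped sum costs at most finitely many of the masses. *)
Lemma open_mass_bigcup (G : nat -> set V) : (forall k, open (G k)) ->
  (open_mass (\bigcup_k G k) <= \sum_(k <oo) open_mass (G k))%E.
Proof.
move=> oG; apply: ge_ereal_sup => _ [f [cf fG] <-].
have /choice[h hP] := fun k => V_exh (oG k).
have ch k n : continuous01 (h k n) by have [+ _ _ _] := hP k.
have mh k x : {homo (h k)^~ x : m n / (m <= n)%N >-> m <= n}.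
  by have [_ + _ _] := hP k.
have h0 k n x : 0 <= h k n x by have [_ /(_ x)/andP[]] := ch k n.
have f01 x : 0 <= f x <= 1 by have [_] := cf.
pose s K x := \sum_(k < K) h k K x.
have s0 K x : 0 <= s K x by apply: sumr_ge0.
have sS K x : s K x <= s K.+1 x.
  rewrite /s big_ord_recr/= -[leLHS]addr0 lerD// ler_sum// => k _.
  exact/mh/leqnSn.
pose g K x := Num.min (s K x) (f x).
have cg K : continuous01 (g K).
  apply: continuous01_min => //.
  by apply: continuous_bigsum => k _; exact: (ch k K).1.
have cfg K : continuous01 (fun x => f x - g K x).
  split => x; first by apply: cvgB; [exact: cf.1|exact: (cg K).1].
  have := f01 x; have [_ /(_ x)] := cg K.
  by rewrite /g; case: (leP (s K x) (f x)); lra.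
have fg0 x : f x - g K x @[K --> \oo] --> 0.
  apply: cvg_near_cst; have [[k _ Gkx]|nGx] := pselect ((\bigcup_k G k) x); last first.
    by apply: nearW => K; rewrite /g fG// min_r// subrr.
  have [_ _ _ /(_ x Gkx)[n hn]] := hP k.
  exists (maxn k.+1 n) => // K /=; rewrite geq_max => /andP[kK nK].
  rewrite /g min_r ?subrr//; have /andP[_ /le_trans] := f01 x; apply.
  rewrite -hn /s (bigD1 (Ordinal kK))//= -[leLHS]addr0 lerD//; first exact: mh.
  exact: sumr_ge0.
apply/lee_addgt0Pr => e e0.
have [K LK] := limit_functional_smooth mu_cvg cfg
  (fun K x => lerB (lexx (f x)) (le_min2 (sS K x) (lexx (f x)))) fg0 e0.
rewrite (@le_trans _ _ (\sum_(k < K) open_mass (G k) + e%:E)%E)//; last first.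
  rewrite leeD2r// -(big_mkord xpredT (fun k => open_mass (G k))).
  by apply: nneseries_lim_ge => k _ _; exact: open_mass_ge0.
rewrite (@le_trans _ _ ((\sum_(k < K) L (h k K))%:E + e%:E)%E)//; last first.
  rewrite leeD2r// -sumEFin; apply: lee_sum => k _.
  by apply: le_limit_open_mass => // x Gx; have [_ _ /(_ K x Gx)] := hP k.
rewrite -EFinD lee_fin.
have := limit_functional_subadd mu_cvg (cg K) (cfg K) cf.
move=> /(_ (fun x => ltac:(lra))) fgK.
have := @limit_functional_sum _ _ _ mu_cvg _ (index_enum 'I_K) (fun k => h k K) (g K) 1 (cg K).
rewrite mul1r => /(_ (fun k => ch k K)) gs.
have /gs : forall x, 1 * g K x <= \sum_(k < K) h k K x.
  by move=> x; rewrite mul1r /g ge_min lexx.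
lra.
Qed.

Lemma outer_mass_open G : open G -> outer_mass G = open_mass G.
Proof.
move=> oG; apply/eqP; rewrite eq_le; apply/andP; split.
  by apply: ereal_inf_lbound; exists G => //; split.
by apply: le_ereal_inf_tmp => _ [H [_ GH] <-]; exact: le_open_mass.
Qed.

Lemma outer_mass_le_open B G : open G -> B `<=` G -> (outer_mass B <= open_mass G)%E.
Proof. by move=> oG BG; apply: ereal_inf_lbound; exists G. Qed.

Lemma outer_mass_ge0 B : (0 <= outer_mass B)%E.
Proof. by apply: le_ereal_inf_tmp => _ [G _ <-]; exact: open_mass_ge0. Qed.

Lemma outer_mass_fin_num B : outer_mass B \is a fin_num.
Proof.
rewrite ge0_fin_numE ?outer_mass_ge0// (@le_lt_trans _ _ 1%E) ?ltry//.
by rewrite (le_trans (outer_mass_le_open openT (@subsetT _ B)))// open_mass_le1.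
Qed.

Lemma outer_massT : outer_mass setT = 1%E.
Proof.
rewrite outer_mass_open; last exact: openT.
apply/eqP; rewrite eq_le open_mass_le1/=.
rewrite (_ : 1%E = (L (fun=> 1))%:E); last by rewrite limit_functional_cst.
apply: le_limit_open_mass => [|x /(_ I)//].
by apply: continuous01_cst; rewrite lexx ler01.
Qed.

Lemma outer_mass0 : outer_mass set0 = 0%E.
Proof.
rewrite outer_mass_open; last exact: open0.
apply/eqP; rewrite eq_le open_mass_ge0 andbT.
apply: ge_ereal_sup => _ [f [_ f0] <-].
by rewrite (_ : f = fun=> 0) ?limit_functional_cst//; apply/funext => x; exact: f0.
Qed.

Lemma outer_mass_sigma_subadditive A F : subset_sigma_subadditive outer_mass A F.
Proof.
move=> AF; apply/lee_addgt0Pr => e e0.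
have /choice[G GP] : forall n, exists G, [/\ open G, F n `<=` G &
    (open_mass G <= outer_mass (F n) + (e / (2 ^ n.+1)%:R)%:E)%E].
  move=> n.
  have en : 0 < e / (2 ^ n.+1)%:R :> R by rewrite divr_gt0// ltr0n expn_gt0.
  have [_ [G [oG FG] <-] GF] := lb_ereal_inf_adherent en (outer_mass_fin_num (F n)).
  by exists G; split => //; exact: ltW.
have oG k : open (G k) by have [] := GP k.
rewrite (@le_trans _ _ (\sum_(n <oo) (outer_mass (F n) + (e / (2 ^ n.+1)%:R)%:E))%E)//.
  have oU : open (\bigcup_k G k) by exact: bigcup_open.
  apply: le_trans (outer_mass_le_open oU _) _.
    by apply: (subset_trans AF) => x [n _ Fx]; exists n => //; have [_ + _] := GP n; apply.
  apply: le_trans (open_mass_bigcup oG) _.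
  apply: lee_nneseries => [n _ _|n _]; first exact: open_mass_ge0.
  by have [] := GP n.
by apply: epsilon_trick => [n|]; [exact: outer_mass_ge0|exact: ltW].
Qed.

HB.instance Definition _ := isSubsetOuterMeasure.Build R V outer_mass
  outer_mass0 outer_mass_ge0 outer_mass_sigma_subadditive.

(* The proof cuts [f <= 1_(U `&` G)] at height [e], so that the functions
   supported by [U `&` [set x | f x < e]] can be added to it. *)
Lemma open_caratheodory G : open G -> outer_mass.-caratheodory G.
Proof.
move=> oG; apply: le_caratheodory_measurable => X.
apply: le_ereal_inf_tmp => _ [U [oU XU] <-].
apply/lee_addgt0Pr => e' e'0.
(* One [e] is lost in choosing [f] near the supremum and another in cutting it down to [f'];
   [e <= 1] keeps the constant [e] in [continuous01]. *)
pose e := Num.min (e' / 2) 1.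
have [e0 e1 ee'] : [/\ 0 < e, e <= 1 & e + e <= e'].
  rewrite /e; split; first by rewrite lt_min ltr01 divr_gt0.
    by rewrite ge_min lexx orbT.
  by case: (leP (e' / 2) 1); lra.
have [_ [f [cf fUG] <-] Lf] := ub_ereal_sup_adherent e0 (open_mass_fin_num (U `&` G)).
have f01 x : 0 <= f x <= 1 by have [_] := cf.
pose f' x : R := Num.max (f x - e) 0.
have cf' : continuous01 f'.
  split => x; last by have := f01 x; rewrite /f'; case: (leP (f x - e) 0); lra.
  apply: (@continuous_max _ _ (fun x => f x - e) (fun=> 0)); last exact: cvg_cst.
  by apply: cvgB; [exact: cf.1|exact: cvg_cst].
have ff' : L f <= L f' + e.
  rewrite -[X in _ + X](limit_functional_cst mu e).
  apply: limit_functional_subadd => //; first by apply: continuous01_cst; lra.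
  by move=> x; rewrite /f'; case: (leP (f x - e) 0); lra.
pose W := U `&` [set x | f x < e].
have oW : open W.
  apply: openI => //; apply: (@open_comp _ _ f [set y | y < e]); last exact: open_lt.
  by move=> x _; exact: cf.1.
have XW : X `&` ~` G `<=` W.
  move=> x [Xx nGx]; split; first exact: XU.
  by rewrite /= fUG// => -[].
have LW : (open_mass W <= open_mass U - (L f')%:E)%E.
  apply: ge_ereal_sup => _ [h [ch hW] <-].
  rewrite leeBrDr// -EFinD.
  have f'h x : 0 < f' x -> h x = 0.
    rewrite /f' lt_max ltxx orbF subr_gt0 => ex; apply: hW => -[_ /=].
    by rewrite ltNge (ltW ex).
  have ck : continuous01 (fun x => h x + f' x).
    split => x; first by apply: cvgD; [exact: ch.1|exact: cf'.1].
    have [_ /(_ x)] := ch; have [_ /(_ x)] := cf'; have := f'h x.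
    by case: (ltP 0 (f' x)) => [? /(_ isT) ->|]; lra.
  rewrite (@le_trans _ _ (L (fun x => h x + f' x))%:E)//.
    by rewrite lee_fin; apply: limit_functional_superadd.
  apply: le_limit_open_mass => // x nUx.
  rewrite hW; last by case.
  by rewrite /f' fUG ?add0r; [case: (leP (- e) 0); lra|case].
have := leeD (outer_mass_le_open (openI oU oG) (@setSI _ G _ _ XU)) (outer_mass_le_open oW XW).
move/le_trans; apply.
have {}Lf : (open_mass (U `&` G) - e%:E < (L f)%:E)%E := Lf.
move: Lf LW; rewrite -(fineK (open_mass_fin_num (U `&` G))).
rewrite -(fineK (open_mass_fin_num U)) -(fineK (open_mass_fin_num W)).
rewrite -!EFinB -!EFinD !lee_fin lte_fin; lra.
Qed.

Let borel_caratheodory (A : set (borelType V)) :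
  measurable A -> outer_mass.-cara.-measurable A.
Proof.
apply: smallest_sub.
  exact: (@sigma_algebra_measurable _ (caratheodory_type outer_mass)).
exact: open_caratheodory.
Qed.

Definition mass : set (borelType V) -> \bar R := outer_mass.

Let mass_sigma_additive : semi_sigma_additive mass.
Proof.
move=> A mA tA mAU; apply: (caratheodory_measure_sigma_additive (mu := outer_mass)) => //.
- by move=> i; exact: borel_caratheodory.
- exact: borel_caratheodory.
Qed.

HB.instance Definition _ := isMeasure.Build _ _ _ mass
  outer_mass0 outer_mass_ge0 mass_sigma_additive.
HB.instance Definition _ := Measure_isProbability.Build _ _ _ mass outer_massT.

(* Layer cake: [N * f] is the sum of the [N] layers of [N * f]. *)
Lemma limit_functional_le_mass f (m : nat) : continuous01 f ->
  L f <= \int[mass]_x f x + m.+1%:R^-1.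
Proof.
set N := m.+1 => cf.
have f01 x : 0 <= f x <= 1 by have [_] := cf.
(* The layer of [N * f] between heights [k] and [k + 1]. It lies between the indicators of [G k.+1]
   and [G k] below; the shift by one level costs at most 1, that is [N^-1] after division. *)
pose w k x := Num.min (Num.max (N%:R * f x - k%:R) 0) 1.
have cw k : continuous01 (w k).
  apply: continuous01_min; last 2 first.
  - by apply: continuous01_cst; rewrite lexx ler01.
  - by move=> x; rewrite le_max lexx orbT.
  move=> x; apply: (@continuous_max _ _ (fun x => N%:R * f x - k%:R) (fun=> 0)).
    apply: cvgB; last exact: cvg_cst.
    by apply: cvgM; [exact: cvg_cst|exact: cf.1].
  exact: cvg_cst.
have sw n x : \sum_(k < n) w k x = Num.min (N%:R * f x) n%:R.
  elim: n => [|n IHn].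
    by rewrite big_ord0 min_r// mulr_ge0//; have /andP[] := f01 x.
  rewrite big_ord_recr/= IHn /w -natr1.
  move: (N%:R * f x) => a; case: (leP a n%:R) => an; case: (leP a (n%:R + 1)) => an1;
    case: (leP (a - n%:R) 0) => an0;
    [case: (leP (0 : R) 1)|case: (leP (a - n%:R) 1)| case: (leP (0 : R) 1)|
     case: (leP (a - n%:R) 1)| case: (leP (0 : R) 1)|case: (leP (a - n%:R) 1)|
     case: (leP (0 : R) 1)|case: (leP (a - n%:R) 1)]; lra.
have N0' : 0 < N%:R :> R by rewrite ltr0n.
pose G k := [set x | k%:R < N%:R * f x].
have oG k : open (G k).
  apply: (@open_comp _ _ (fun x => N%:R * f x) [set y | k%:R < y]); last exact: open_gt.
  by move=> x _; apply: cvgM; [exact: cvg_cst|exact: cf.1].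
have mG k : measurable (G k : set (borelType V)) by apply: sub_sigma_algebra.
have wG k : L (w k) <= fine (mass (G k)).
  rewrite -lee_fin fineK; last exact: outer_mass_fin_num.
  rewrite /mass outer_mass_open//; apply: le_limit_open_mass => // x /negP.
  rewrite -leNgt => fk; rewrite /w max_r ?min_l//; lra.
have sG x : \sum_(k < N) \1_(G k) x <= N%:R * f x + 1.
  have -> : \sum_(k < N) \1_(G k) x = \1_(G 0%N) x + \sum_(k < m) \1_(G k.+1) x :> R.
    by rewrite big_ord_recl.
  rewrite addrC lerD//.
  rewrite (@le_trans _ _ (\sum_(k < m) w k x))//; last by rewrite sw ge_min lexx.
  apply: ler_sum => k _; rewrite indicE; case: (boolP (x \in G k.+1)).
    rewrite inE /G /= -natr1 /w => kN.
    have k1 : 1 <= N%:R * f x - k%:R by lra.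
    by rewrite max_l ?min_r// (le_trans ler01).
  by move=> _; have [_ /(_ x)/andP[]] := cw k.
rewrite -(ler_pM2l N0') mulrDr divff ?gt_eqF//.
apply: (@le_trans _ _ (\sum_(k < N) L (w k))).
  apply: limit_functional_sum => // x; rewrite sw min_l//.
  by rewrite ler_piMr//; have /andP[] := f01 x.
apply: (@le_trans _ _ (\sum_(k < N) fine (mass (G k)))); first exact: ler_sum.
under eq_bigr do rewrite -(mean_indic mass (mG _)).
have b1 k : bounded_measurable (\1_(G k) : borelType V -> R) by exact: bounded_measurable_indic.
have bf := bounded_measurable_continuous01 cf.
have bNf : bounded_measurable (fun x : borelType V => N%:R * f x).
  by apply: bounded_measurableM => //; exact: bounded_measurable_cst.
rewrite -mean_sum; last by move=> k _; exact: b1.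
rewrite -[X in _ <= _ + X](mean_cst mass 1) -meanZ// -meanD//.
- apply: le_mean => //; first by apply: bounded_measurable_sum.
  apply: bounded_measurableD; last exact: bounded_measurable_cst.
  exact: bNf.
- exact: bounded_measurable_cst.
Qed.

(** The bound of [L] by the integral holds for [f] and for [1 - f]. As [L f + L (1 - f)] is at least
    1, the total mass, both bounds are equalities. *)
Theorem weak_limit_exists : exists nu : probability (borelType V) R,
  forall f : V -> R, continuous01 f ->
    \int[mu n]_x f x @[n --> \oo] --> \int[nu]_x f x.
Proof.
exists mass => f cf.
suff -> : \int[mass]_x f x = L f by exact: limit_functional_cvg.
have leL g : continuous01 g -> L g <= \int[mass]_x g x.
  move=> cg; apply/ler_addgt0Pr => e e0.
  have [N _ /(_ _ (leqnn _))] := near_infty_natSinv_lt (PosNum e0).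
  move=> /= Ne; rewrite (le_trans (limit_functional_le_mass N cg))//.
  by rewrite lerD2l ltW.
apply/eqP; rewrite eq_le leL// andbT.
have cf' := continuous01_compl cf.
have := leL _ cf'; rewrite meanB; last 2 first.
- exact: bounded_measurable_cst.
- exact: bounded_measurable_continuous01.
rewrite mean_cst.
have c1 : continuous01 ((fun=> 1) : V -> R) by apply: continuous01_cst; rewrite lexx ler01.
have := limit_functional_subadd mu_cvg cf cf' c1.
rewrite limit_functional_cst => /(_ (fun x => ltac:(lra))); lra.
Qed.

End OuterMass.

(** * Countable bases of cozero sets, and tightness *)

Section CountableBase.
Context (R : realType) (V : topologicalType).

(** The cozero sets of the [phi n] form a base. Unlike a metric, such a family passes to sequences
    by finite products, and it yields both the exhaustion of open sets and the measurability of maps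
    into the space. *)
Definition countable_base01 (phi : nat -> V -> R) :=
  (forall n, continuous01 (phi n)) /\
  forall x O, open O -> O x ->
    exists n, 0 < phi n x /\ forall y, 0 < phi n y -> O y.

(** An open [G] is the union of the cozero sets it contains, selected by the coefficients [c n]. The
    partial sums are thus eventually positive at each point of [G], and the growing factor [N%:R]
    drives them past 1, where they are truncated. *)
Lemma countable_base01_exhaustible phi : countable_base01 phi -> open_exhaustible R V.
Proof.
move=> [cphi phiP] G oG.
pose c n : R := (`[< forall y, 0 < phi n y -> G y >] : nat)%:R.
pose s N x := \sum_(n < N) c n * phi n x.
have phi0 n x : 0 <= phi n x by have [_ /(_ x)/andP[]] := cphi n.
have t0 n x : 0 <= c n * phi n x by rewrite mulr_ge0// ler0n.
have s0 N x : 0 <= s N x by apply: sumr_ge0.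
have hs x : {homo s ^~ x : m n / (m <= n)%N >-> m <= n}.
  by apply/nondecreasing_seqP => N; rewrite /s big_ord_recr/= lerDl.
exists (fun N x => Num.min (N%:R * s N x) 1); split.
- move=> N; apply: continuous01_min; last 2 first.
  + by apply: continuous01_cst; rewrite lexx ler01.
  + by move=> x; rewrite mulr_ge0// ler0n.
  move=> x; apply: cvgM; first exact: cvg_cst.
  apply: continuous_bigsum => n _ {}x.
  by apply: cvgM; [exact: cvg_cst|exact: (cphi n).1].
- move=> x m n mn; rewrite le_min2// ler_pM ?ler0n ?ler_nat//; exact: hs.
- move=> N x nGx; rewrite /s big1 ?mulr0 ?min_l// => n _.
  rewrite /c; case: asboolP => [h|_]; last by rewrite mul0r.
  suff -> : phi n x = 0 by rewrite mulr0.
  by apply/eqP; rewrite eq_le phi0 andbT leNgt; apply/negP => /h.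
- move=> x Gx; have [n [phin phiG]] := phiP x G oG Gx.
  have [m _ mP] := near_infty_natSinv_lt (PosNum phin).
  exists (maxn n.+1 m.+1); rewrite min_r//.
  have sn : phi n x <= s (maxn n.+1 m.+1) x.
    rewrite (le_trans _ (hs x _ _ (leq_maxl _ _)))// /s big_ord_recr/= /c asboolT// mul1r.
    by rewrite lerDr; apply: sumr_ge0 => i _; exact: t0.
  apply: (@le_trans _ _ (m.+1%:R * phi n x)).
    have /= := mP m (leqnn _); rewrite invf_plt ?posrE// => /ltW phim.
    by rewrite -[leLHS](mulVf (lt0r_neq0 phin)) ler_wpM2r.
  by rewrite ler_pM ?ler0n ?ler_nat ?leq_maxr.
Qed.

End CountableBase.

Section MeasurableIntoBase.
Context (R : realType) (V : ptopologicalType) d (Omega : measurableType d).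

(** Each open set is a countable union of cozero sets of the base. On the sequence space this
    reduces Borel measurability to that of functions of finitely many coordinates. *)
Lemma measurable_countable_base01 (phi : nat -> V -> R) (Y : Omega -> borelType V) :
  countable_base01 phi ->
  (forall n, measurable_fun setT (fun w => phi n (Y w))) -> measurable_fun setT Y.
Proof.
move=> [cphi phiP] mY.
apply: (@measurability _ _ Omega (borelType V) setT Y (@open V)) => //.
move=> _ [Q oQ <-]; rewrite setTI.
rewrite (_ : _ @^-1` _ =
    \bigcup_(n in [set n | forall y, 0 < phi n y -> Q y]) (fun w => phi n (Y w)) @^-1` `]0, +oo[%classic).
  apply: bigcup_measurable => n _; rewrite -[X in measurable X]setTI.
  by apply: mY => //; exact: measurable_itv.
apply/seteqP; split => w /=.
  by move=> QY; have [n [phin nQ]] := phiP _ _ oQ QY; exists n => //=; rewrite in_itv/= phin.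
by move=> [n nQ /=]; rewrite in_itv/= andbT => /nQ.
Qed.

End MeasurableIntoBase.

HB.instance Definition _ (I : Type) (T : I -> ptopologicalType) :=
  isPointed.Build (prod_topology T) (fun=> point).

(** * The product topology on sequences *)

Section SequenceSpace.
Context (R : realType) (S : topologicalType).

(** The sets containing a box around [x] on an initial segment of coordinates form a filter. The
    product topology is a supremum of initial topologies, so convergence of this filter to [x] is
    checked one coordinate at a time. *)
Lemma nbhs_ptws (x : {ptws nat -> S}) (A : set {ptws nat -> S}) : nbhs x A ->
  exists k (U : nat -> set S), (forall i, nbhs (x i) (U i)) /\
    forall y, (forall i, (i < k)%N -> U i (y i)) -> A y.
Proof.
pose F : set_system {ptws nat -> S} := [set A | exists k (U : nat -> set S),
  (forall i, nbhs (x i) (U i)) /\ forall y : nat -> S,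
  (forall i, (i < k)%N -> U i (y i)) -> A y].
have FF : Filter F.
  split.
  - by exists 0%N, (fun=> setT); split => // i; exact: filterT.
  - move=> P Q [k [U [nU UP]]] [l [W [nW WQ]]].
    exists (maxn k l), (fun i => U i `&` W i); split => [i|y UWy].
      exact: filterI.
    split; [apply: UP|apply: WQ] => i ik; have [] // := UWy i;
      by rewrite (leq_trans ik)// ?leq_maxl ?leq_maxr.
  - move=> P Q PQ [k [U [nU UP]]]; exists k, U; split => // y Uy.
    exact/PQ/UP.
suff : F --> x by exact.
apply/cvg_sup => i W [_ [[Q oQ <-] Qx QW]].
exists i.+1, (fun j => if j == i then Q else setT); split => [j|y Oy].
  case: eqP => [->|_]; last exact: filterT.
  by apply: open_nbhs_nbhs.
by apply: QW => /=; have := Oy i (ltnSn i); rewrite eqxx.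
Qed.

Lemma ptws_proj_continuous i : continuous (fun x : {ptws nat -> S} => x i).
Proof. exact: (@proj_continuous nat (fun=> S) i). Qed.

(* [m] codes a finite list of indices into [phi], one for each of the first
   coordinates. *)
Definition cylinder_base (phi : nat -> S -> R) (m : nat) (x : {ptws nat -> S}) : R :=
  if choice.unpickle m is Some s then \prod_(i < size s) phi (nth 0%N s i) (x i) else 0.

Lemma cylinder_base01 phi : countable_base01 phi -> countable_base01 (cylinder_base phi).
Proof.
move=> [cphi phiP]; split.
  move=> m; rewrite /cylinder_base; case: choice.unpickle => [s|]; last first.
    by apply: continuous01_cst; rewrite lexx ler01.
  split => x.
    apply: continuous_bigprod => i _ y.
    apply: (@continuous_comp _ _ _ (fun y : {ptws nat -> S} => y i)).
      exact: ptws_proj_continuous.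
    exact: (cphi _).1.
  have phi01 n y : 0 <= phi n y <= 1 by have [_] := cphi n.
  rewrite prodr_ge0//=; last by move=> i _; have /andP[] := phi01 (nth 0%N s i) (x i).
  by apply: Num.Theory.prodr_ile1 => i _; exact: phi01.
move=> x O oO Ox.
have [k [U [nU UO]]] := nbhs_ptws (open_nbhs_nbhs (conj oO Ox)).
have /choice[f fP] : forall i, exists n, 0 < phi n (x i) /\ forall y, 0 < phi n y -> U i y.
  move=> i; have := nU i; rewrite nbhsE => -[W [oW Wx] WU].
  have [n [n0 nW]] := phiP _ _ oW Wx.
  by exists n; split => // y /nW /WU.
exists (choice.pickle (mkseq f k)).
have E y : cylinder_base phi (choice.pickle (mkseq f k)) y = \prod_(i < k) phi (f i) (y i).
  rewrite /cylinder_base choice.pickleK size_mkseq.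
  by apply: eq_bigr => i _; rewrite nth_mkseq.
split; first by rewrite E prodr_gt0// => i _; have [] := fP i.
move=> y; rewrite E => p0; apply: UO => i ik; apply: (fP i).2.
have phi0 n z : 0 <= phi n z by have [_ /(_ z)/andP[]] := cphi n.
rewrite lt_neqAle phi0 andbT eq_sym; apply: contraTneq p0 => fi0.
by rewrite (bigD1 (Ordinal ik))//= fi0 mul0r ltxx.
Qed.

End SequenceSpace.

Lemma decreasing_measure_lt (R : realType) d (Y : measurableType d) (nu : probability Y R)
    (A : nat -> set Y) (c : R) : (forall n, measurable (A n)) ->
  (forall n, A n.+1 `<=` A n) -> (nu (\bigcap_n A n) < c%:E)%E ->
  exists n, (nu (A n) < c%:E)%E.
Proof.
move=> mA dA nuc.
have mcap : measurable (\bigcap_n A n) by exact: bigcapT_measurable.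
have ndA : nonincreasing_seq A.
  by apply/nonincreasing_seqP => n; apply/subsetPset; exact: dA.
have A0 : (nu (A 0%N) < +oo)%E by rewrite ltey_eq fin_num_measure.
have cvA := nonincreasing_cvg_mu A0 mA mcap ndA.
apply: contrapT => /forallNP nA.
have {}nA n : (c%:E <= nu (A n))%E by rewrite leNgt; apply/negP/nA.
move: nuc; rewrite -(cvg_lim (@ereal_hausdorff R) cvA) ltNge => /negP; apply.
by apply: lime_ge; [exact: cvgP cvA|exact: nearW].
Qed.

(** * Borel subsets of a Polish space: countable base, regularity, tightness *)

Section MetricPullback.
Context (R : realType) (S : ptopologicalType) (T : metricType R) (e : S -> T).
Hypothesis T_polish : polish_metric T.
Hypothesis openS : @open S = [set e @^-1` U | U in @open T].
Hypothesis range_e : <<s @open T >> (range e).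

Let D (x y : S) : R := mdist (e x) (e y).

Lemma ball_mdist (a : T) (r : R) : ball a r = [set t | mdist a t < r].
Proof. exact: ballEmdist. Qed.

Lemma mdist_continuous (a : T) : continuous (mdist a : T -> R).
Proof.
move=> t; apply/cvgrPdist_lt => r r0; near=> u.
have : ball t r u by near: u; exact: nbhsx_ballx.
rewrite ball_mdist /= => tu.
have := metric_triangle a t u; have := metric_triangle a u t.
rewrite (metric_sym u t) ltr_norml; lra.
Unshelve. all: by end_near. Qed.

Lemma pullback_continuous : continuous e.
Proof.
by apply/continuousP => U oU; rewrite openS; exists U.
Qed.

Lemma open_mball (a : T) (r : R) : open [set t | mdist a t < r].
Proof.
apply: (@open_comp _ _ (mdist a) [set y | y < r]); last exact: open_lt.
by move=> t _; exact: mdist_continuous.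
Qed.

Lemma closed_mball (a : T) (r : R) : closed [set t | mdist a t <= r].
Proof.
apply: (@preimage_closed _ _ (mdist a) [set y | y <= r]); last exact: closed_le.
by move=> t _; exact: mdist_continuous.
Qed.

Lemma open_ball_sub (U : set T) t : open U -> U t ->
  exists n : nat, forall u, mdist t u < n.+1%:R^-1 -> U u.
Proof.
move=> oU Ut; have : nbhs t U by exact: open_nbhs_nbhs.
rewrite -nbhs_ballE => -[r /= r0 rU].
have [n _ nr] := near_infty_natSinv_lt (PosNum r0).
exists n => u tu; apply: rU; rewrite ball_mdist /=.
exact/(lt_trans tu)/(nr n (leqnn _)).
Qed.

Lemma pullback_nbhs (x : S) (A : set S) : nbhs x A ->
  exists2 r : R, 0 < r & forall y, D x y < r -> A y.
Proof.
rewrite nbhsE => -[B [+ Bx] BA]; rewrite openS => -[U oU UB].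
have Ux : U (e x) by move: Bx; rewrite -UB.
have [n nU] := open_ball_sub oU Ux.
by exists n.+1%:R^-1 => // y xy; apply: BA; rewrite -UB; exact: nU.
Qed.

Lemma nbhs_pullback (x : S) (r : R) : 0 < r -> nbhs x [set y | D x y < r].
Proof.
move=> r0; apply: open_nbhs_nbhs; split; last by rewrite /= /D mdistxx.
by rewrite openS; exists [set t | mdist (e x) t < r] => //; exact: open_mball.
Qed.

Lemma pullback_dist_continuous (a : T) : continuous (fun x => mdist a (e x) : R).
Proof.
by move=> x; apply: (@continuous_comp _ _ _ e); [exact: pullback_continuous|exact: mdist_continuous].
Qed.

Lemma dense_sequence : exists a : nat -> T, forall t (r : R), 0 < r ->
  exists n, mdist (a n) t < r.
Proof.
have [_ [C /countable_injP[f injf] dC]] := T_polish.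
(* [f] numbers the countable dense set [C] injectively; numbers that are not attained get the
   default [e point]. *)
exists (fun n => xget (e point) (C `&` [set t | f t = n])) => t r r0.
have [|c [ct Cc]] := dC [set u | mdist t u < r] _ (open_mball t r).
  by exists t; rewrite /= mdistxx.
exists (f c); case: xgetP => [u uE [Cu fu]|/(_ c)]; last by case.
by rewrite (injf u c) ?inE// metric_sym.
Qed.

(** Tents of height and radius [j.+1%:R^-1] around the points [a i] of a dense sequence of [T],
    composed with [e]. The centres need not be in the range of [e]. *)
Lemma pullback_base : exists phi : nat -> S -> R, countable_base01 phi.
Proof.
have [a aP] := dense_sequence.
pose psi i (j : nat) x : R := Num.max (j.+1%:R^-1 - mdist (a i) (e x)) 0.
have cpsi i j : continuous01 (psi i j).
  split => x.
    apply: (@continuous_max _ _ (fun x => j.+1%:R^-1 - mdist (a i) (e x)) (fun=> 0)).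
      by apply: cvgB; [exact: cvg_cst|exact: pullback_dist_continuous].
    exact: cvg_cst.
  rewrite /psi le_max lexx orbT/= ge_max ler01 andbT.
  rewrite lerBlDr (@le_trans _ _ 1)//; last by rewrite lerDl mdist_ge0.
  by rewrite invf_le1// ler1n.
exists (fun n x => if choice.unpickle n is Some (i, j) then psi i j x else 0); split.
  move=> n; case: choice.unpickle => [[i j]|]; first exact: cpsi.
  by apply: continuous01_cst; rewrite lexx ler01.
move=> x O; rewrite openS => -[U oU <-] Ux.
have [n nU] := open_ball_sub oU Ux.
(* [j.+1] is twice [n.+1], so that two tent radii, joined at [a i] by the triangle inequality, add
   up to [n.+1%:R^-1]. *)
pose j := n.+1.*2.-1.
have j2 : j.+1%:R^-1 + j.+1%:R^-1 = n.+1%:R^-1 :> R.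
  by rewrite [RHS]splitr /j prednK ?double_gt0// -muln2 natrM invfM.
have [i ij] : exists i, mdist (a i) (e x) < j.+1%:R^-1 by apply: aP.
exists (choice.pickle (i, j)); rewrite choice.pickleK; split.
  by rewrite lt_max subr_gt0 ij.
move=> y; rewrite lt_max ltxx orbF subr_gt0 => ijy.
apply: nU; rewrite -j2 (le_lt_trans (metric_triangle _ (a i) _))//.
by rewrite ltrD// metric_sym.
Qed.


Section Tightness.
Variable mu : probability (borelType S) R.

Let preimage_open_measurable (G : set T) : open G ->
  measurable (e @^-1` G : set (borelType S)).
Proof. by move=> oG; apply: sub_sigma_algebra; rewrite openS; exists G. Qed.

Let preimage_closed_measurable (F : set T) : closed F ->
  measurable (e @^-1` F : set (borelType S)).
Proof.
move=> /closed_openC/preimage_open_measurable/measurableC.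
by rewrite -preimage_setC setCK.
Qed.

Let preimage_diff_measurable (G F : set T) : open G -> closed F ->
  measurable (e @^-1` (G `\` F) : set (borelType S)).
Proof.
move=> oG cF.
exact: (measurableD (preimage_open_measurable oG) (preimage_closed_measurable cF)).
Qed.

(** Regularity of the image law on [T]. The sandwich is made in [T] because it will give, inside the
    range of [e], a set closed in the complete space. *)
Let regular (B : set T) := forall r : R, 0 < r -> exists F G : set T,
  [/\ closed F, open G, F `<=` B, B `<=` G & (mu (e @^-1` (G `\` F)) < r%:E)%E].

Let regular_open U : open U -> regular U.
Proof.
move=> oU r r0.
pose F n := ~` (\bigcup_(t in ~` U) [set u | mdist t u < n.+1%:R^-1]).
have cF n : closed (F n).
  by apply: open_closedC; apply: bigcup_open => t _; exact: open_mball.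
have FU n : F n `<=` U.
  move=> t Ft; apply: contrapT => nUt; apply: Ft; exists t => //=.
  by rewrite mdistxx invr_gt0 ltr0n.
have [n hn] : exists n, (mu (e @^-1` (U `\` F n)) < r%:E)%E.
  apply: decreasing_measure_lt.
  - move=> n; exact: preimage_diff_measurable.
  - move=> n x /= [Ux nFx]; split => // Fx; apply: nFx => -[t nUt tx].
    apply: Fx; exists t => //=; apply: (lt_trans tx).
    by rewrite ltf_pV2 ?posrE ?ltr0n// ltr_nat.
  - rewrite (_ : \bigcap_n _ = set0) ?measure0 ?lte_fin//.
    rewrite -subset0 => x h; have [Ux _] := h 0%N I.
    have [n nU] := open_ball_sub oU Ux.
    have [_] := h n I; apply => -[t nUt tx]; apply/nUt/nU.
    by rewrite metric_sym.
by exists (F n), U; split.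
Qed.

Let regularC B : regular B -> regular (setT `\` B).
Proof.
move=> rB r r0; have [F [G [cF oG FB BG FG]]] := rB r r0.
exists (~` G), (~` F); split.
- exact: open_closedC.
- exact: closed_openC.
- by move=> t nGt; split => // /BG.
- by move=> t [_ nBt] /FB.
- by rewrite setDE setCK setIC -setDE.
Qed.

Let regular_bigcup (B : nat -> set T) : (forall n, regular (B n)) ->
  regular (\bigcup_n B n).
Proof.
move=> rB r r0.
have r2 : 0 < r / 2 by rewrite divr_gt0.
have /choice[FG FGP] : forall n, exists FG : set T * set T,
    [/\ closed FG.1, open FG.2, FG.1 `<=` B n, B n `<=` FG.2
      & (mu (e @^-1` (FG.2 `\` FG.1)) < (r / 2 / (2 ^ n.+1)%:R)%:E)%E].
  move=> n; have rn : 0 < r / 2 / (2 ^ n.+1)%:R by rewrite divr_gt0// ltr0n expn_gt0.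
  by have [F [G FGP]] := rB n _ rn; exists (F, G).
pose G := \bigcup_n (FG n).2.
have oG : open G by apply: bigcup_open => n _; have [] := FGP n.
(* The union of all the closed sets may fail to be closed; finite unions are closed, and continuity
   from above makes the mass they miss small. *)
pose F n := \bigcup_(i in `I_n) (FG i).1.
have cF n : closed (F n).
  apply: closed_bigcup; first exact: finite_II.
  by move=> i _; have [] := FGP i.
have [n hn] : exists n, (mu (e @^-1` (G `\` F n)) < r%:E)%E.
  apply: decreasing_measure_lt.
  - move=> n; exact: preimage_diff_measurable.
  - move=> n x /= [Gx nFx]; split => // -[i /= ni Fx]; apply: nFx.
    by exists i => //=; rewrite (leq_trans ni).
  - have mFG i : measurable (e @^-1` ((FG i).2 `\` (FG i).1) : set (borelType S)).
      have [cFi oGi _ _ _] := FGP i.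
      exact: preimage_diff_measurable.
    apply: (@le_lt_trans _ _ (r / 2)%:E); last by rewrite lte_fin; lra.
    apply: (@le_trans _ _ (\sum_(i <oo) mu (e @^-1` ((FG i).2 `\` (FG i).1)))%E).
      apply: measure_sigma_subadditive => //.
        apply: bigcapT_measurable => n; exact: preimage_diff_measurable.
      move=> x h; have [[i _ Gix] _] := h 0%N I.
      exists i => //; split => // Fix'; have [_] := h i.+1 I; apply.
      by exists i => /=.
    apply: le_trans (@epsilon_trick0 R (r / 2) xpredT (ltW r2)).
    apply: lee_nneseries => [i _ _|i _]; first exact: measure_ge0.
    by apply: ltW; have [] := FGP i.
exists (F n), G; split => //.
- by move=> t [i _ Fit]; exists i => //; have [_ _ + _ _] := FGP i; apply.
- by move=> t [i _ Bit]; exists i => //; have [_ _ _ + _] := FGP i; apply.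
Qed.

Let regular_borel B : <<s @open T >> B -> regular B.
Proof.
apply: smallest_sub; last exact: regular_open.
split; [|exact: regularC|exact: regular_bigcup].
by apply: regular_open; exact: open0.
Qed.

(* Ulam: a closed set filling the range of [e] up to [r], cut by finitely many
   closed balls of each radius. *)
Lemma pullback_tight (r : R) : 0 < r -> exists K : set (borelType S),
  [/\ compact (K : set S), measurable K & (mu (~` K) <= r%:E)%E].
Proof.
move=> r0.
have r2 : 0 < r / 2 by rewrite divr_gt0.
have [F [G [cF oG Fe eG FG]]] := regular_borel range_e r2.
have [a aP] := dense_sequence.
pose C N (m : nat) := \bigcup_(i in `I_N) [set t | mdist (a i) t <= m.+1%:R^-1].
have cC N m : closed (C N m).
  by apply: closed_bigcup; [exact: finite_II|move=> i _; exact: closed_mball].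
have /choice[N NP] : forall m, exists N,
    (mu (e @^-1` (~` C N m)) < (r / 2 / (2 ^ m.+1)%:R)%:E)%E.
  move=> m; apply: decreasing_measure_lt.
  - by move=> n; apply: preimage_open_measurable; exact: closed_openC.
  - by move=> n x /= nC -[i /= ni xi]; apply: nC; exists i => //=; rewrite (leq_trans ni).
  - rewrite (_ : \bigcap_n _ = set0).
      by rewrite measure0 lte_fin divr_gt0// ltr0n expn_gt0.
    rewrite -subset0 => x h.
    have [|i ix] := aP (e x) (m.+1%:R^-1); first by rewrite invr_gt0 ltr0n.
    by apply: (h i.+1 I); exists i => //=; exact: ltW.
pose K' := F `&` \bigcap_m C (N m) m.
have cK' : closed K' by apply: closedI => //; apply: closed_bigI => m _; exact: cC.
exists (e @^-1` K'); split.
(* At each radius an ultrafilter on the set contains one of finitely many balls, so its image in [T]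
   is Cauchy. The limit lies in [F], hence in the range of [e], and convergence comes back to [S]
   because its topology is induced by [e]. *)
- rewrite compact_ultra => U UU UK.
  have PeU : ProperFilter (e @ U) by apply: fmap_proper_filter.
  have eUK : (e @ U) K' by [].
  have [|t eUt] := T_polish.1 (e @ U) PeU.
    apply: cauchy_exP => s s0.
    have [m _ /(_ _ (leqnn _))/= ms] := near_infty_natSinv_lt (PosNum s0).
    have UC : U (e @^-1` C (N m) m) by apply: filterS UK => x [_]; apply.
    have [i Ui] : exists i, U (e @^-1` [set t | mdist (a i) t <= m.+1%:R^-1]).
      apply: contrapT => /forallNP nU.
      have {}nU i : U (~` (e @^-1` [set t | mdist (a i) t <= m.+1%:R^-1])).
        by have [/nU|] := in_ultra_setVsetC (e @^-1` [set t | mdist (a i) t <= m.+1%:R^-1]) UU.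
      have nUC n : U (~` (e @^-1` C n m)).
        elim: n => [|n IHn]; first by apply: filterS filterT => x _ [].
        apply: filterS (filterI IHn (nU n)) => x [nCx nx] [i /= + xi].
        by rewrite ltnS leq_eqVlt => /predU1P[iE|iN]; [apply: nx; rewrite -iE|apply: nCx; exists i].
      have : U (e @^-1` C (N m) m `&` ~` (e @^-1` C (N m) m)) by exact: filterI.
      by move=> /filter_ex[x [Cx nCx]]; exact: nCx.
    exists (a i); apply: filterS Ui => x /= aix; rewrite ball_mdist/=.
    exact: le_lt_trans ms.
  have K't : K' t by apply: (@closed_cvg _ T U _ e K' cK' UK t).
  have [x _ ext] := Fe _ K't.1.
  exists x; split; first by rewrite /= ext.
  move=> A /pullback_nbhs[s s0 sA].
  have UB : U (e @^-1` ball t s) by apply: eUt; exact: nbhsx_ballx.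
  by apply: filterS UB => y /=; rewrite ball_mdist -ext /= => ?; exact: sA.
- exact: (preimage_closed_measurable cK').
- have mF : measurable (~` (e @^-1` F) : set (borelType S)).
    exact: (measurableC (preimage_closed_measurable cF)).
  have mC m : measurable (~` (e @^-1` (C (N m) m)) : set (borelType S)).
    exact: (measurableC (preimage_closed_measurable (cC _ _))).
  rewrite preimage_setI preimage_bigcap setCI setC_bigcap.
  apply: le_trans (measureU2 _ mF (bigcupT_measurable _ mC)) _.
  rewrite [r in r%:E]splitr EFinD; apply: leeD.
    apply: le_trans (ltW FG).
    apply: le_measure; rewrite ?inE//.
      exact: preimage_diff_measurable.
    by move=> x nFx; split => //; apply: eG; exists x.
  apply: (@le_trans _ _ (\sum_(m <oo) mu (~` (e @^-1` (C (N m) m))))%E).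
    by apply: generalized_Boole_inequality => //; exact: bigcupT_measurable.
  apply: le_trans (@epsilon_trick0 R (r / 2) xpredT (ltW r2)).
  apply: lee_nneseries => [i _ _|i _]; first exact: measure_ge0.
  exact/ltW/NP.
Qed.

End Tightness.

End MetricPullback.

(** * Conditioning on the past *)

Section BoundedMeasurableInduction.
Context (R : realType).

(** The sum counts the integers [k < N] below [a]: it is the ceiling of [a], truncated at [N]. *)
Lemma sum_level_indicators (a : R) (N : nat) : 0 <= a ->
  Num.min a N%:R <= \sum_(k < N) (k%:R < a)%R%:R <= Num.min (a + 1) N%:R.
Proof.
move=> a0; elim: N => [|N IHN]; first by rewrite big_ord0 (min_r a0) min_r ?lexx ?addr_ge0.
rewrite big_ord_recr/= -natr1; move: IHN.
by case: (ltP N%:R a) => ? /=; case: (leP (a + 1) N%:R) => ?;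
  case: (leP a (N%:R + 1)) => ?; case: (leP (a + 1) (N%:R + 1)) => ?; lra.
Qed.

(** A bounded function is a uniform limit of combinations of indicators of its level sets. The
    closure premise is in terms of uniform approximation, which suits identities between means and
    avoids monotone limits. *)
Lemma bounded_measurable_ind d (T : measurableType d) (Q : (T -> R) -> Prop) :
  (forall A, measurable A -> Q \1_A) ->
  (forall f g, bounded_measurable f -> bounded_measurable g ->
    Q f -> Q g -> Q (fun x => f x + g x)) ->
  (forall c f, bounded_measurable f -> Q f -> Q (fun x => c * f x)) ->
  (forall f, bounded_measurable f -> (forall e : R, 0 < e -> exists g,
    [/\ bounded_measurable g, Q g & forall x, `|f x - g x| <= e]) -> Q f) ->
  forall f, bounded_measurable f -> Q f.
Proof.
move=> Q1 QD QZ Qlim f bf; apply: Qlim => // e e0.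
have [mf [M fM]] := bf.
have M0 : 0 <= M by exact: le_trans (fM point).
(* [N] is chosen to make the mesh [(2 * M + 1) / N] at most [e]. The interval from [-M] to [M] has
   length [2 * M]; the extra 1 keeps the divisor positive when [M = 0]. *)
have [n _ /(_ _ (leqnn _))] := near_infty_natSinv_lt
  (PosNum (divr_gt0 e0 (ltr_wpDl (mulr_ge0 (ler0n R 2) M0) ltr01))).
set N := n.+1 => /=; have N0 : 0 < N%:R :> R by rewrite ltr0n.
rewrite ltr_pdivlMr; last by lra.
move=> Ne.
pose u x := (f x + M) * N%:R / (2 * M + 1).
have u0 x : 0 <= u x.
  rewrite divr_ge0 ?mulr_ge0 ?ler0n//; last by lra.
  by have := fM x; rewrite ler_norml; lra.
have uN x : u x <= N%:R.
  rewrite ler_pdivrMr; last by lra.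
  rewrite mulrC ler_pM2l//; have := fM x; rewrite ler_norml; lra.
pose A k := [set x | k%:R < u x].
have mfu : measurable_fun setT u.
  apply: measurable_funM; last exact: measurable_cst.
  apply: measurable_funM; last exact: measurable_cst.
  by apply: measurable_funD.
have mA k : measurable (A k).
  rewrite (_ : A k = u @^-1` `]k%:R, +oo[%classic).
    by rewrite -[X in measurable X]setTI; apply: mfu.
  by apply/seteqP; split => x /=; rewrite in_itv/= andbT.
pose s m x : R := \sum_(k < m) \1_(A k) x.
have bQ m : bounded_measurable (s m) /\ Q (s m).
  elim: m => [|m [bm Qm]].
    rewrite (_ : s 0%N = fun x => 0 * \1_setT x); last first.
      by apply/funext => x; rewrite /s big_ord0 mul0r.
    split.
      apply: bounded_measurableM; first exact: bounded_measurable_cst.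
      exact: bounded_measurable_indic.
    by apply: QZ; [exact: bounded_measurable_indic|exact: Q1].
  rewrite (_ : s m.+1 = fun x => s m x + \1_(A m) x); last first.
    by apply/funext => x; rewrite /s big_ord_recr.
  have bA := bounded_measurable_indic R (mA m).
  by split; [exact: bounded_measurableD|apply: QD => //; exact: Q1].
have [bN QN] := bQ N.
pose c := (2 * M + 1) / N%:R.
exists (fun x => c * s N x + (- M) * \1_setT x); split.
- apply: bounded_measurableD; apply: bounded_measurableM => //.
  + exact: bounded_measurable_cst.
  + exact: bounded_measurable_cst.
  + exact: bounded_measurable_indic.
- apply: QD.
  + by apply: bounded_measurableM => //; exact: bounded_measurable_cst.
  + apply: bounded_measurableM; first exact: bounded_measurable_cst.
    exact: bounded_measurable_indic.
  + exact: QZ.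
  + by apply: QZ; [exact: bounded_measurable_indic|exact: Q1].
- move=> x; rewrite indicT mulr1.
  have := sum_level_indicators N (u0 x); rewrite (min_l (uN x)).
  have -> : \sum_(k < N) (k%:R < u x)%R%:R = s N x.
    by apply: eq_bigr => k _; rewrite indicE mem_setE.
  move=> /andP[us su].
  have {}su : s N x <= u x + 1 by rewrite (le_trans su)// ge_min lexx.
  have fE : f x + M = c * u x.
    by rewrite /c /u; field; rewrite !gt_eqF//=; lra.
  have c0 : 0 < c by rewrite divr_gt0//; lra.
  have ce : c <= e by rewrite /c mulrC ltW.
  have h1 : c * u x <= c * s N x by rewrite ler_pM2l.
  have h2 : c * s N x <= c * (u x + 1) by rewrite ler_pM2l.
  rewrite ler_norml; lra.
Qed.

End BoundedMeasurableInduction.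

Section KernelExpectation.
Context (R : realType) d d' (X : measurableType d) (Y : measurableType d').
Variable k : R.-pker X ~> Y.

(** A named copy of [k x] that carries the structure of a probability, so that the results on means
    apply at each point. *)
Definition kernel_at (x : X) : set Y -> \bar R := k x.

HB.instance Definition _ x := Measure.on (kernel_at x).
HB.instance Definition _ x :=
  Measure_isProbability.Build _ _ _ (kernel_at x) (prob_kernel x).

Lemma kernel_meanE x (f : Y -> R) :
  \int[k x]_y f y = \int[kernel_at x]_y f y.
Proof. by []. Qed.

Lemma kernel_mean_indic x (B : set Y) : measurable B ->
  \int[k x]_y \1_B y = fine (k x B).
Proof. by move=> mB; rewrite kernel_meanE mean_indic. Qed.

Lemma kernel_mean_bound x (f : Y -> R) (M : R) : bounded_measurable f ->
  (forall y, `|f y| <= M) -> `|\int[k x]_y f y| <= M.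
Proof.
move=> bf fM; rewrite kernel_meanE (le_trans (norm_mean_le _ bf))//.
rewrite -(mean_cst (kernel_at x) M); apply: le_mean => //.
- exact: bounded_measurable_norm.
- exact: bounded_measurable_cst.
Qed.

Lemma kernel_mean01 x (f : Y -> R) : bounded_measurable f ->
  (forall y, 0 <= f y <= 1) -> 0 <= \int[k x]_y f y <= 1.
Proof.
move=> bf f01; rewrite Rintegral_ge0/=; last by move=> y _; have /andP[] := f01 y.
rewrite (le_trans (ler_norm _))//; apply: kernel_mean_bound => // y.
by have /andP[? ?] := f01 y; rewrite ger0_norm.
Qed.

Lemma kernel_mean_dist x (f g : Y -> R) (e : R) : bounded_measurable f ->
  bounded_measurable g -> (forall y, `|f y - g y| <= e) ->
  `|\int[k x]_y f y - \int[k x]_y g y| <= e.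
Proof.
move=> bf bg fg; rewrite !kernel_meanE -meanB// -kernel_meanE.
by apply: kernel_mean_bound => //; exact: bounded_measurableB.
Qed.

(* The kernel may be measurable for a coarser sigma-field than that of [X]. *)
Lemma kernel_mean_measurable d0 (X0 : measurableType d0) (h : X0 -> X) :
  (forall B, measurable B -> measurable_fun setT (fun x => k (h x) B)) ->
  forall f, bounded_measurable f ->
    bounded_measurable (fun x => \int[k (h x)]_y f y).
Proof.
move=> mk; apply: bounded_measurable_ind.
- move=> B mB; rewrite (_ : (fun x => _) = fun x => fine (k (h x) B)); last first.
    by apply/funext => x; rewrite kernel_mean_indic.
  split; first by apply: measurableT_comp => //; exact: mk.
  exists 1 => x; rewrite -kernel_mean_indic//.
  apply: kernel_mean_bound; first exact: bounded_measurable_indic.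
  by move=> y; rewrite ger0_norm indicE ?ler0n// lern1 leq_b1.
- move=> f g bf bg Qf Qg.
  rewrite (_ : (fun x => _) = fun x => \int[k (h x)]_y f y + \int[k (h x)]_y g y).
    exact: bounded_measurableD.
  by apply/funext => x; rewrite !kernel_meanE meanD.
- move=> c f bf Qf.
  rewrite (_ : (fun x => _) = fun x => c * \int[k (h x)]_y f y).
    by apply: bounded_measurableM => //; exact: bounded_measurable_cst.
  by apply/funext => x; rewrite !kernel_meanE meanZ.
- move=> f bf fQ.
  have /choice[g gP] : forall n : nat, exists g, [/\ bounded_measurable g,
      bounded_measurable (fun x => \int[k (h x)]_y g y)
      & forall y, `|f y - g y| <= n.+1%:R^-1].
    by move=> n; apply: fQ; rewrite invr_gt0 ltr0n.
  split; last first.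
    have [_ [M fM]] := bf.
    by exists M => x; exact: kernel_mean_bound.
  apply: (@measurable_fun_cvg _ _ _ _ (fun n x => \int[k (h x)]_y g n y)).
    by move=> n; have [_ [+ _] _] := gP n.
  move=> x _; apply/cvgrPdist_le => e e0.
  have [n _ nP] := near_infty_natSinv_lt (PosNum e0).
  exists n => // m /= /nP/= me; rewrite (le_trans _ (ltW me))//.
  by have [bg _ fg] := gP m; exact: kernel_mean_dist.
Qed.

End KernelExpectation.

Section Predictive.
Context (R : realType) (S : ptopologicalType) d (Omega : measurableType d)
  (P : probability Omega R) (X : nat -> {RV P >-> borelType S}).

(** [Omega] as a measurable space under the sigma-field of the past: measurability with respect to
    the past becomes ordinary measurability, and the induction on bounded measurable functions
    applies to it. *)
Definition past_space (n : nat) := g_sigma_algebraType (past X n).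

Lemma past_sigma_algebra n : sigma_algebra setT (past X n).
Proof. exact: smallest_sigma_algebra. Qed.

Lemma past_spaceE n : @measurable _ (past_space n) = past X n.
Proof. exact/measurable_g_measurableTypeE/past_sigma_algebra. Qed.

Lemma past_sub n (M : set (set Omega)) : sigma_algebra setT M ->
  (forall (i : nat) (A : set (borelType S)), (i < n)%N -> measurable A -> M (X i @^-1` A)) ->
  past X n `<=` M.
Proof.
move=> sM XM; apply: smallest_sub => //.
rewrite -bigcup_seq => _ [i _ [A mA <-]]; rewrite setTI.
exact: XM.
Qed.

Lemma past_measurable n : past X n `<=` @measurable _ Omega.
Proof.
apply: past_sub; first exact: sigma_algebra_measurable.
by move=> i A _ mA; rewrite -[X in measurable X]setTI; apply: measurable_funPT.
Qed.

Lemma past_preimage n i (A : set (borelType S)) : (i < n)%N -> measurable A ->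
  past X n (X i @^-1` A).
Proof.
move=> ni mA; apply: sub_sigma_algebra; rewrite -bigcup_seq.
by exists (Ordinal ni); [rewrite /= mem_index_enum|exists A => //; rewrite setTI].
Qed.

Lemma past_mono m n : (m <= n)%N -> past X m `<=` past X n.
Proof.
move=> mn; apply: past_sub; first exact: past_sigma_algebra.
by move=> i A im; apply: past_preimage; exact: leq_trans mn.
Qed.

Lemma past_widen m n d' (Y : measurableType d') (W : Omega -> Y) : (m <= n)%N ->
  measurable_fun setT (W : past_space m -> Y) ->
  measurable_fun setT (W : past_space n -> Y).
Proof.
move=> mn mW _ A mA; have := mW measurableT A mA; rewrite !past_spaceE.
exact: past_mono.
Qed.

Lemma past_forget n d' (Y : measurableType d') (W : Omega -> Y) :
  measurable_fun setT (W : past_space n -> Y) -> measurable_fun setT W.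
Proof.
move=> mW _ A mA; have := mW measurableT A mA; rewrite past_spaceE.
exact: past_measurable.
Qed.

Lemma bounded_past_forget n (W : Omega -> R) :
  bounded_measurable (W : past_space n -> R) -> bounded_measurable W.
Proof. by move=> [mW bW]; split => //; exact: past_forget mW. Qed.

Lemma past_variable n i : (i < n)%N ->
  measurable_fun setT (X i : past_space n -> borelType S).
Proof. by move=> ni _ A mA; rewrite setTI past_spaceE; exact: past_preimage. Qed.

Lemma variable_bounded i (f : S -> R) :
  bounded_measurable (f : borelType S -> R) -> bounded_measurable (fun w => f (X i w)).
Proof. by move=> bf; apply: (bounded_measurable_comp (measurable_funPT (X i)) bf). Qed.

Variable alpha : nat -> R.-pker Omega ~> borelType S.
Hypothesis alphaP : forall n, is_predictive X n (alpha n).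

Lemma predictive_past n (f : borelType S -> R) : bounded_measurable f ->
  bounded_measurable ((fun w => \int[alpha n w]_x f x) : past_space n -> R).
Proof.
apply: (kernel_mean_measurable (h := (id : past_space n -> Omega))).
move=> B mB _ V mV; rewrite setTI past_spaceE.
by have [+ _] := alphaP n mB; apply.
Qed.

Lemma predictive_bounded n (f : borelType S -> R) : bounded_measurable f ->
  bounded_measurable (fun w => \int[alpha n w]_x f x).
Proof. by move=> bf; exact: bounded_past_forget (predictive_past n bf). Qed.

(** Both sides are linear and continuous for the uniform norm in each of [W] and [f]. An induction
    on [W], then on [f], reduces the identity to indicators, where it is the defining property of
    [is_predictive]. *)
Lemma mean_predictive n (W : Omega -> R) (f : borelType S -> R) :
  bounded_measurable (W : past_space n -> R) -> bounded_measurable f ->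
  \int[P]_w (W w * f (X n w)) = \int[P]_w (W w * \int[alpha n w]_x f x).
Proof.
have uniform (U V G : Omega -> R) e M : bounded_measurable U ->
    bounded_measurable V -> bounded_measurable G -> (forall w, `|U w - V w| <= e) ->
    (forall w, `|G w| <= M) ->
    `|\int[P]_w (U w * G w) - \int[P]_w (V w * G w)| <= e * M.
  move=> bU bV bG UV GM.
  have bUG := bounded_measurableM bU bG; have bVG := bounded_measurableM bV bG.
  rewrite -meanB//.
  apply: le_trans (norm_mean_le _ (bounded_measurableB bUG bVG)) _.
  rewrite -(mean_cst P (e * M)); apply: le_mean.
  - exact/bounded_measurable_norm/bounded_measurableB.
  - exact: bounded_measurable_cst.
  - by move=> w; rewrite -mulrBl normrM ler_pM.
have limit (a b : R) (M : R) : 0 <= M ->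
    (forall e : R, 0 < e -> exists c, `|a - c| <= e * M /\ `|b - c| <= e * M) -> a = b.
  move=> M0 ab; apply/eqP; rewrite -subr_eq0 -normr_le0; apply/ler_addgt0Pr => e e0.
  (* With this choice each of the two errors is at most [e / 2], including when [M = 0]. *)
  have [|c []] := ab (e / (2 * M + 1)); first by rewrite divr_gt0//; lra.
  have : e / (2 * M + 1) * M <= e / 2.
    rewrite mulrAC ler_pdivrMr; last lra.
    by rewrite -mulrA -subr_ge0; nra.
  rewrite add0r !ler_norml; lra.
move=> bW; move: W bW f.
have bX (f : borelType S -> R) : bounded_measurable f ->
    bounded_measurable (fun w => f (X n w)).
  exact: variable_bounded.
have bA := @predictive_bounded n.
apply: (@bounded_measurable_ind _ _ (past_space n)).
- move=> A; rewrite past_spaceE => pA.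
  have mA := past_measurable pA.
  have b1 : bounded_measurable (\1_A : Omega -> R) by exact: bounded_measurable_indic.
  apply: bounded_measurable_ind.
  + move=> B mB; have mXB : measurable (X n @^-1` B).
      by rewrite -[X in measurable X]setTI; apply: measurable_funPT.
    have -> : \int[P]_w (\1_A w * \1_B (X n w)) = fine (P (A `&` X n @^-1` B)).
      rewrite -mean_indic; last exact: measurableI.
      by apply: eq_Rintegral => w _; rewrite indicI.
    have [_ /(_ A pA) <-] := alphaP n mB.
    rewrite integral_mkcond; congr fine; apply: eq_integral => w _.
    rewrite patchE indicE; case: ifP => _; last by rewrite mul0r.
    rewrite mul1r kernel_mean_indic// fineK//.
    exact: (fin_num_measure (kernel_at (alpha n) w)).
  + move=> f g bf bg If Ig.
    transitivity (\int[P]_w (\1_A w * f (X n w) + \1_A w * g (X n w))).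
      by apply: eq_Rintegral => w _; rewrite mulrDr.
    rewrite meanD; [|exact: bounded_measurableM b1 (bX _ _)..].
    rewrite If Ig -meanD; [|exact: bounded_measurableM b1 (bA _ _)..].
    apply: eq_Rintegral => w _.
    by rewrite -mulrDr !kernel_meanE meanD.
  + move=> c f bf If.
    transitivity (\int[P]_w (c * (\1_A w * f (X n w)))).
      by apply: eq_Rintegral => w _; rewrite mulrCA.
    rewrite meanZ; last exact: bounded_measurableM b1 (bX _ _).
    rewrite If -meanZ; last exact: bounded_measurableM b1 (bA _ _).
    apply: eq_Rintegral => w _.
    by rewrite mulrCA !kernel_meanE meanZ.
  + move=> f bf fQ; apply: (limit _ _ 1 ler01) => e e0.
    have [g [bg Ig fg]] := fQ e e0.
    have A1 w : `|\1_A w : R| <= 1 by rewrite ger0_norm indicE ?ler0n// lern1 leq_b1.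
    exists (\int[P]_w (\1_A w * g (X n w))); split; last rewrite Ig.
      under eq_Rintegral do rewrite mulrC.
      under [X in _ - X]eq_Rintegral do rewrite mulrC.
      exact: uniform (bX _ bf) (bX _ bg) b1 (fun w => fg (X n w)) A1.
    under eq_Rintegral do rewrite mulrC.
    under [X in _ - X]eq_Rintegral do rewrite mulrC.
    apply: uniform (bA _ bf) (bA _ bg) b1 _ A1 => w.
    exact: kernel_mean_dist.
- move=> U V /bounded_past_forget bU /bounded_past_forget bV IU IV f bf.
  transitivity (\int[P]_w (U w * f (X n w) + V w * f (X n w))).
    by apply: eq_Rintegral => w _; rewrite mulrDl.
  rewrite meanD; [|exact: bounded_measurableM (bX _ bf)..].
  rewrite IU// IV// -meanD; [|exact: bounded_measurableM (bA _ bf)..].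
  by apply: eq_Rintegral => w _; rewrite mulrDl.
- move=> c U /bounded_past_forget bU IU f bf.
  transitivity (\int[P]_w (c * (U w * f (X n w)))).
    by apply: eq_Rintegral => w _; rewrite mulrA.
  rewrite meanZ; last exact: bounded_measurableM (bX _ bf).
  rewrite IU// -meanZ; last exact: bounded_measurableM (bA _ bf).
  by apply: eq_Rintegral => w _; rewrite mulrA.
- move=> U /bounded_past_forget bU UQ f bf.
  have [_ [M fM]] := bf.
  apply: (limit _ _ M); first exact: le_trans (fM point).
  move=> e e0; have [V [/bounded_past_forget bV IV UV]] := UQ e e0.
  exists (\int[P]_w (V w * f (X n w))); split; last rewrite IV//.
    by apply: uniform => //; exact: bX.
  by apply: uniform => //; [exact: bA|move=> w; exact: kernel_mean_bound].
Qed.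

End Predictive.

(** * Limits of the means of cylinder functions *)

Section ConvergenceInProbability.
Context (R : realType) d (Omega : measurableType d) (P : probability Omega R).

(** Off [A n] and [A m] the two variables are within [e / 2] of each other; on these sets, each of
    mean at most [e / 4], they differ by at most 1. [L] may be unbounded and occurs only in the
    exceptional sets, never in an integral. *)
Lemma cvg_in_probability_L1_cauchy (Y : nat -> Omega -> R) :
  (forall n, measurable_fun setT (Y n)) -> (forall n w, 0 <= Y n w <= 1) ->
  cvg_in_probability P Y -> forall e : R, 0 < e ->
    exists N : nat, forall n m, (N <= n)%N -> (N <= m)%N ->
      \int[P]_w `|Y n w - Y m w| <= e.
Proof.
move=> mY Y01 [L YL] e e0.
have e4 : 0 < e / 4 by rewrite divr_gt0.
pose A n := [set w | e / 4 < `|Y n w - L w|].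
have mA n : measurable (A n).
  have mYL : measurable_fun setT (fun w => `|Y n w - L w|).
    by apply: measurableT_comp => //; apply: measurable_funB.
  rewrite (_ : A n = (fun w => `|Y n w - L w|) @^-1` `]e / 4, +oo[%classic).
    by rewrite -[X in measurable X]setTI; exact: mYL.
  by apply/seteqP; split => w /=; rewrite in_itv/= andbT.
have /fine_cvg/cvgrPdist_le/(_ _ e4)[N _ NP] := YL _ e4.
exists N => n m Nn Nm.
have PA k : (N <= k)%N -> \int[P]_w \1_(A k) w <= e / 4.
  move=> Nk; rewrite mean_indic//.
  by have := NP k Nk; rewrite sub0r normrN; apply: le_trans; exact: ler_norm.
have bA k : bounded_measurable (\1_(A k) : Omega -> R) by exact: bounded_measurable_indic.
have bY k : bounded_measurable (Y k).
  by split => //; exists 1 => w; have /andP[? ?] := Y01 k w; rewrite ger0_norm.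
apply: (@le_trans _ _ (\int[P]_w (e / 2 + (\1_(A n) w + \1_(A m) w)))).
  apply: le_mean.
  - exact/bounded_measurable_norm/bounded_measurableB.
  - by apply: bounded_measurableD; [exact: bounded_measurable_cst|exact: bounded_measurableD].
  - move=> w; rewrite !indicE.
    have Yn := Y01 n w; have Ym := Y01 m w.
    case: (boolP (w \in A n)) => [_|/negP]; first by
      have : 0 <= ((w \in A m) : nat)%:R :> R; [rewrite ler0n|rewrite ler_norml/=; lra].
    rewrite inE /A /= => /negP; rewrite -leNgt => An.
    case: (boolP (w \in A m)) => [_|/negP]; first by rewrite ler_norml/=; lra.
    rewrite inE /A /= => /negP; rewrite -leNgt => Am.
    by move: An Am; rewrite !ler_norml; lra.
rewrite meanD//; [|exact: bounded_measurable_cst|exact: bounded_measurableD].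
rewrite meanD// mean_cst.
have := PA n Nn; have := PA m Nm; lra.
Qed.

End ConvergenceInProbability.

Lemma dist_prod_le (R : realType) (k : nat) (a b : 'I_k -> R) :
  (forall i, 0 <= a i <= 1) -> (forall i, 0 <= b i <= 1) ->
  `|\prod_i a i - \prod_i b i| <= \sum_i `|a i - b i|.
Proof.
elim: k a b => [|k IHk] a b a01 b01; first by rewrite !big_ord0 subrr normr0.
rewrite !big_ord_recl.
set pa := \prod_i _; set pb := \prod_(i < k) _.
have pa01 : 0 <= pa <= 1.
  rewrite prodr_ge0/=; last by move=> i _; have /andP[] := a01 (lift ord0 i).
  by apply: Num.Theory.prodr_ile1 => i _; exact: a01.
have -> : a ord0 * pa - b ord0 * pb = (a ord0 - b ord0) * pa + b ord0 * (pa - pb) by ring.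
rewrite (le_trans (ler_normD _ _))// lerD//.
  rewrite normrM ler_piMr// ger0_norm; lra.
rewrite normrM; have := b01 ord0 => b0.
rewrite (@le_trans _ _ `|pa - pb|)//; first by rewrite ler_piMl// ger0_norm; lra.
by apply: IHk => i.
Qed.

Section CylinderLimit.
Context (R : realType) (S : ptopologicalType) d (Omega : measurableType d)
  (P : probability Omega R) (X : nat -> {RV P >-> borelType S})
  (alpha : nat -> R.-pker Omega ~> borelType S).
Hypothesis alphaP : forall n, is_predictive X n (alpha n).
Hypothesis alpha_cvg : forall f : S -> R, continuous f -> bounded_fun f ->
  cvg_in_probability P (fun n w => \int[alpha n w]_x f x).

Let a (f : S -> R) n w := \int[alpha n w]_x f x.

Let bm := @bounded_measurable_continuous01 R S.

Let bma f n : continuous01 f -> bounded_measurable (a f n).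
Proof. by move=> cf; apply: (predictive_bounded alphaP); exact: bm. Qed.

Let a01 f n w : continuous01 f -> 0 <= a f n w <= 1.
Proof. by move=> cf; apply: kernel_mean01; [exact: bm|exact: cf.2]. Qed.

Let bmX (f : S -> R) i : continuous01 f -> bounded_measurable (fun w => f (X i w)).
Proof. by move=> cf; exact: variable_bounded (bm cf). Qed.

Lemma predictive_L1_cauchy f : continuous01 f -> forall e : R, 0 < e ->
  exists N : nat, forall n m, (N <= n)%N -> (N <= m)%N ->
    \int[P]_w `|a f n w - a f m w| <= e.
Proof.
move=> cf; apply: cvg_in_probability_L1_cauchy.
- by move=> n; exact: (bma n cf).1.
- by move=> n w; exact: a01.
- apply: alpha_cvg; first exact: cf.1.
  exists 1; split; rewrite ?num_real// => M M1 x _ /=.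
  by have /andP[f0 f1] := cf.2 x; rewrite ger0_norm// (le_trans f1)// ltW.
Qed.

(* One step of conditioning replaces the last factor [f (X (n + k))] by its
   predictive mean at time [n + k], which is close in mean to the one at time
   [n], and the latter can be absorbed in [W]. *)
Lemma mean_cylinder_dist (n k : nat) (f : nat -> S -> R) (W : Omega -> R) :
  (forall i, continuous01 (f i)) ->
  bounded_measurable (W : past_space X n -> R) -> (forall w, `|W w| <= 1) ->
  `|\int[P]_w (W w * \prod_(i < k) f i (X (n + i)%N w)) -
    \int[P]_w (W w * \prod_(i < k) a (f i) n w)| <=
  \sum_(i < k) \int[P]_w `|a (f i) (n + i)%N w - a (f i) n w|.
Proof.
move=> cf; elim: k W => [|k IHk] W bW W1.
  rewrite big_ord0.
  rewrite (@eq_Rintegral _ _ _ P setT (fun w => W w * \prod_(i < 0) a (f i) n w)).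
    by rewrite subrr normr0.
  by move=> w _; rewrite !big_ord0.
have bW' := bounded_past_forget bW.
pose p k w := \prod_(i < k) f i (X (n + i)%N w).
pose q k w := \prod_(i < k) a (f i) n w.
have bp m : bounded_measurable (p m) by apply: bounded_measurable_prod => i _; exact: bmX.
have bq m : bounded_measurable (q m) by apply: bounded_measurable_prod => i _; exact: bma.
have p1 m w : `|p m w| <= 1.
  rewrite ger0_norm; last by apply: prodr_ge0 => i _; have /andP[] := (cf i).2 (X (n + i)%N w).
  by apply: Num.Theory.prodr_ile1 => i _; exact: (cf i).2.
have a1 m w : `|a (f k) m w| <= 1.
  by have /andP[? ?] := a01 m w (cf k); rewrite ger0_norm.
(* The factors before the last one only involve [X (n + i)] with [i < k], so they belong to the past
   of [n + k] and may stay outside the conditioning. *)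
have bWp : bounded_measurable ((fun w => W w * p k w) : past_space X (n + k) -> R).
  apply: bounded_measurableM.
    by case: bW => mW bdW; split => //; apply: past_widen mW; exact: leq_addr.
  apply: bounded_measurable_prod => i _.
  apply: (bounded_measurable_comp (T := past_space X (n + k)) (h := X (n + i)%N)).
    by apply: past_variable; rewrite ltn_add2l.
  exact: bm.
have step1 : \int[P]_w (W w * p k.+1 w) = \int[P]_w ((W w * p k w) * a (f k) (n + k)%N w).
  rewrite -(mean_predictive alphaP bWp (bm (cf k))).
  by apply: eq_Rintegral => w _; rewrite /p big_ord_recr/= mulrA.
pose W' w := W w * a (f k) n w.
have bW2 : bounded_measurable (W' : past_space X n -> R).
  by apply: bounded_measurableM => //; apply: (predictive_past alphaP); exact: bm.
have W'1 w : `|W' w| <= 1.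
  by rewrite normrM mulr_ile1.
have step2 : \int[P]_w (W w * q k.+1 w) = \int[P]_w (W' w * q k w).
  by apply: eq_Rintegral => w _; rewrite /q /W' big_ord_recr/= mulrAC mulrA.
rewrite -/(p k.+1) step1 step2 big_ord_recr/=.
have bW2' := bounded_past_forget bW2.
have step3 : `|\int[P]_w ((W w * p k w) * a (f k) (n + k)%N w) -
    \int[P]_w (W' w * p k w)| <= \int[P]_w `|a (f k) (n + k)%N w - a (f k) n w|.
  have b1 : bounded_measurable (fun w => (W w * p k w) * a (f k) (n + k)%N w).
    by apply: bounded_measurableM; [exact: bounded_measurableM|exact: bma].
  have b2 : bounded_measurable (fun w => W' w * p k w) by exact: bounded_measurableM.
  rewrite -meanB//.
  apply: le_trans (norm_mean_le _ (bounded_measurableB b1 b2)) _.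
  apply: le_mean.
  - exact/bounded_measurable_norm/bounded_measurableB.
  - by apply/bounded_measurable_norm/bounded_measurableB; exact: bma.
  - move=> w; rewrite /W' [W w * a (f k) n w * _]mulrAC -mulrBr normrM ler_piMl//.
    by rewrite normrM mulr_ile1.
have := IHk W' bW2 W'1.
move: step3.
rewrite -/(p k) -/(q k).
move=> h1 h2; rewrite addrC; apply: le_trans (lerD h1 h2).
by apply: le_trans (ler_normD _ _); rewrite addrA subrK.
Qed.

(** The order of the quantifiers carries the exchangeability: one [l] serves all permutations. It is
    the limit of [b], which is Cauchy because products in [0, 1] differ by at most the sum of the
    differences of their factors. *)
Lemma cylinder_limit (k : nat) (f : 'I_k -> S -> R) :
  (forall i, continuous01 (f i)) -> exists l : R, forall s : 'S_k,
    \int[P]_w (\prod_i f i (X (n + s i)%N w)) @[n --> \oo] --> l.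
Proof.
move=> cf.
pose b n := \int[P]_w (\prod_i a (f i) n w).
have bb n : bounded_measurable (fun w => \prod_i a (f i) n w).
  by apply: bounded_measurable_prod => i _; exact: bma.
have N_ e : 0 < e -> exists N : nat, forall i n m, (N <= n)%N -> (N <= m)%N ->
    \int[P]_w `|a (f i) n w - a (f i) m w| <= e.
  move=> e0; have /choice[N NP] := fun i => predictive_L1_cauchy (cf i) e0.
  exists (\max_i N i)%N => i n m Nn Nm.
  by apply: NP; [apply: leq_trans Nn|apply: leq_trans Nm]; exact: leq_bigmax.
(* Dividing by [m.+1] instead of [m] also covers the empty sum. *)
have sumN (m : nat) (e : R) (F : 'I_m -> R) : 0 < e ->
    (forall i, F i <= e / m.+1%:R) -> \sum_i F i <= e.
  move=> e0 Fe; apply: (@le_trans _ _ (\sum_(i < m) e / m.+1%:R)); first exact: ler_sum.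
  rewrite sumr_const card_ord -[leLHS]mulr_natr mulrAC ler_pdivrMr ?ltr0n//.
  by apply: ler_wpM2l; [exact: ltW|rewrite ler_nat].
have /cauchy_cvgP/cvg_ex[l bl] : cauchy (b @ \oo).
  apply: cauchy_exP => e e0.
  have e20 : 0 < e / 2 / k.+1%:R by rewrite !divr_gt0// ltr0n.
  have [N NP] := N_ _ e20.
  exists (b N), N => // n /= Nn; rewrite /ball/= /b.
  rewrite -meanB//.
  apply: le_lt_trans (norm_mean_le _ (bounded_measurableB (bb _) (bb _))) _.
  apply: (@le_lt_trans _ _ (\int[P]_w (\sum_i `|a (f i) N w - a (f i) n w|))).
    apply: le_mean.
    - exact/bounded_measurable_norm/bounded_measurableB.
    - by apply: bounded_measurable_sum => i _; apply/bounded_measurable_norm/bounded_measurableB; exact: bma.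
    - by move=> w; apply: dist_prod_le => i; exact: a01.
  rewrite mean_sum; last first.
    by move=> i _; apply/bounded_measurable_norm/bounded_measurableB; exact: bma.
  apply: (@le_lt_trans _ _ (e / 2)); last by lra.
  by apply: sumN => [|i]; [rewrite divr_gt0|exact: NP].
exists l => s.
(* The factors listed by time: the one evaluated at [X (n + i)] is [f] at the preimage of [i] under
   [s]. The default 0 concerns only [i >= k], outside the products. *)
pose f' (i : nat) : S -> R := if insub i is Some j then f ((s^-1)%g j) else fun=> 0.
have f'E (i : 'I_k) : f' i = f ((s^-1)%g i) by rewrite /f' valK.
have cf' i : continuous01 (f' i).
  rewrite /f'; case: insubP => [j _ _|_]; first exact: cf.
  by apply: continuous01_cst; rewrite lexx ler01.
have E1 n w : \prod_i f i (X (n + s i)%N w) = \prod_(i < k) f' i (X (n + i)%N w).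
  rewrite (reindex_inj (@perm_inj _ (s^-1)%g)); apply: eq_bigr => i _.
  by rewrite permKV f'E.
have E2 n w : \prod_i a (f i) n w = \prod_(i < k) a (f' i) n w.
  rewrite (reindex_inj (@perm_inj _ (s^-1)%g)); apply: eq_bigr => i _.
  by rewrite f'E.
apply/cvgrPdist_le => e e0.
have e2 : 0 < e / 2 by rewrite divr_gt0.
have e2k : 0 < e / 2 / k.+1%:R by rewrite divr_gt0// ltr0n.
have [N NP] := N_ _ e2k.
have /cvgrPdist_le/(_ _ e2)[N' _ N'P] := bl.
exists (maxn N N') => // n /=; rewrite geq_max => /andP[Nn N'n].
have := N'P n N'n; rewrite /=.
have := @mean_cylinder_dist n k f' (fun=> 1) cf' (bounded_measurable_cst _ _).
rewrite normr1 => /(_ (fun=> lexx _)).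
under eq_Rintegral do rewrite mul1r -E1.
under [X in _ - X]eq_Rintegral do rewrite mul1r -E2.
rewrite -/(b n).
have : \sum_(i < k) \int[P]_w `|a (f' i) (n + i)%N w - a (f' i) n w| <= e / 2.
  apply: sumN => // i; rewrite f'E; apply: NP => //.
  by rewrite (leq_trans Nn)// leq_addr.
rewrite !ler_norml; lra.
Qed.

End CylinderLimit.

(** * Convergence in law of the shifted sequence *)

Section PartitionOfUnity.
Context (R : realType) (S : ptopologicalType) (T : metricType R) (e : S -> T).
Hypothesis openS : @open S = [set e @^-1` U | U in @open T].

Let D (x y : S) : R := mdist (e x) (e y).

Let D_triangle x y z : D x z <= D x y + D y z.
Proof. exact: metric_triangle. Qed.

Let D_continuous z : continuous (D z).
Proof. exact: pullback_dist_continuous. Qed.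

(** Off [K] the sum is only at most 1, and its defect from 1 will measure the escape from [K].
    Functions of index at least [N] vanish, so that one length [M] can serve several compact sets at
    once. *)
Lemma compact_partition_of_unity (K : set S) (r : R) : compact K -> K !=set0 -> 0 < r ->
  exists (N : nat) (z : nat -> S) (rho : nat -> S -> R),
    [/\ forall l, K (z l), forall l, continuous01 (rho l),
        forall l x, 0 < rho l x -> D (z l) x < r,
        forall M x, \sum_(l < M) rho l x <= 1
      & forall M x, (N <= M)%N -> K x -> \sum_(l < M) rho l x = 1].
Proof.
move=> cK [x0 Kx0] r0.
have [F FK KF] : finite_subset_cover K (fun z => [set x | D z x < r / 2]) K.
  have /(_ S K (fun z => [set x | D z x < r / 2])) : cover_compact K by rewrite -compact_cover.
  apply.
    move=> z _; apply: (@open_comp _ _ (D z) [set y | y < r / 2]); last exact: open_lt.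
    by move=> x _; exact: D_continuous.
  by move=> x Kx; exists x => //=; rewrite /D mdistxx divr_gt0.
pose s : seq S := finmap.enum_fset F; pose N := size s; pose z l := nth x0 s l.
have Kz l : K (z l).
  have [lN|lN] := ltnP l N; last by rewrite /z nth_default.
  by have /FK := mem_nth x0 lN; rewrite inE.
(* Equal to 1 up to distance [r / 2] from [z l], the radius of the finite cover, and to 0 from
   distance [r] on. *)
pose chi l x := Num.min (Num.max (2 - D (z l) x * (2 / r)) 0) 1.
have cchi l : continuous01 (chi l).
  apply: continuous01_min; last 2 first.
  - by apply: continuous01_cst; rewrite lexx ler01.
  - by move=> x; rewrite le_max lexx orbT.
  move=> x; apply: (@continuous_max _ _ (fun x => 2 - D (z l) x * (2 / r)) (fun=> 0)).
    apply: cvgB; first exact: cvg_cst.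
    by apply: cvgM; [exact: D_continuous|exact: cvg_cst].
  exact: cvg_cst.
have chi0 l x : 0 <= chi l x by have /andP[] := (cchi l).2 x.
(* The maximum with 1 makes the division continuous everywhere; on [K] the sum is already at least
   1, so nothing changes there. *)
pose den x := Num.max (\sum_(l < N) chi l x) 1.
have den1 x : 1 <= den x by rewrite le_max lexx orbT.
have den0 x : 0 < den x := lt_le_trans ltr01 (den1 x).
have cden : continuous den.
  move=> x; apply: (@continuous_max _ _ (fun x => \sum_(l < N) chi l x) (fun=> 1)).
    by apply: continuous_bigsum => l _; exact: (cchi l).1.
  exact: cvg_cst.
pose rho l x := if (l < N)%N then chi l x / den x else 0.
have rho0 l x : 0 <= rho l x.
  by rewrite /rho; case: ifP => // _; rewrite divr_ge0// ltW.
have sN x : \sum_(l < N) rho l x = (\sum_(l < N) chi l x) / den x.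
  by rewrite mulr_suml; apply: eq_bigr => l _; rewrite /rho ltn_ord.
have sM M x : \sum_(l < M) rho l x <= \sum_(l < N) rho l x.
  have [MN|NM] := leqP M N.
    rewrite -!(big_mkord xpredT (fun l => rho l x)) [leRHS](@big_cat_nat _ _ _ M)//=.
    by rewrite lerDl sumr_ge0.
  rewrite -!(big_mkord xpredT (fun l => rho l x)) [leLHS](@big_cat_nat _ _ _ N)//=; last exact: ltnW.
  rewrite [X in _ + X](_ : _ = 0) ?addr0// big_nat big1// => l /andP[Nl _].
  by rewrite /rho ltnNge Nl.
have sN1 x : \sum_(l < N) rho l x <= 1.
  by rewrite sN ler_pdivrMr// mul1r le_max lexx.
have sM1 M x : \sum_(l < M) rho l x <= 1 by exact: le_trans (sM M x) (sN1 x).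
exists N, z, rho; split => //.
- move=> l; split => x.
    have [lN|Nl] := ltnP l N; last first.
      rewrite (_ : rho l = fun=> 0); first exact: cvg_cst.
      by apply/funext => y; rewrite /rho ltnNge Nl.
    rewrite (_ : rho l = fun y => chi l y / den y); last first.
      by apply/funext => y; rewrite /rho lN.
    apply: cvgM; first exact: (cchi l).1.
    by apply: cvgV; [rewrite gt_eqF|exact: cden].
  rewrite rho0/=; apply: le_trans (sM1 l.+1 x).
  by rewrite big_ord_recr/= lerDr sumr_ge0.
- move=> l x; rewrite /rho; case: ifP => lN; last by rewrite ltxx.
  rewrite pmulr_lgt0 ?invr_gt0// /chi lt_min ltr01 andbT lt_max ltxx orbF subr_gt0.
  by rewrite mulrA ltr_pdivrMr// mulrC ltr_pM2l.
- move=> M x NM Kx; apply/eqP; rewrite eq_le sM1/=.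
  apply: (@le_trans _ _ (\sum_(l < N) rho l x)); last first.
    rewrite -!(big_mkord xpredT (fun l => rho l x)) [leRHS](@big_cat_nat _ _ _ N)//=.
    by rewrite lerDl sumr_ge0.
  have [w wF /= wx] := KF x Kx.
  have iN : (index w s < N)%N by rewrite index_mem.
  have chi1 : chi (index w s) x = 1.
    rewrite /chi /z nth_index// min_r//.
    rewrite le_max; apply/orP; left.
    have : D w x * (2 / r) <= 1 by rewrite mulrA ler_pdivrMr// mul1r; lra.
    lra.
  have chis : 1 <= \sum_(l < N) chi l x.
    by rewrite (bigD1 (Ordinal iN))//= chi1 lerDl sumr_ge0.
  by rewrite sN /den max_l// divff// gt_eqF// (lt_le_trans ltr01).
Qed.

(* The product of the [K i] is compact by Tychonoff, hence near-covering. *)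
Lemma product_uniform_continuity (K : nat -> set S) (g : {ptws nat -> S} -> R) (eta : R) :
  (forall i, compact (K i)) -> continuous g -> 0 < eta ->
  exists m : nat, forall x y : nat -> S, (forall i, K i (x i)) ->
    (forall i, (i < m)%N -> D (x i) (y i) < m.+1%:R^-1) -> `|g y - g x| <= eta.
Proof.
move=> cK cg eta0.
have cP : compact [set x : {ptws nat -> S} | forall i, K i (x i)].
  exact: (@tychonoff nat (fun=> S) K cK).
pose Q (m : nat) (x : {ptws nat -> S}) := forall y : nat -> S,
  (forall i, (i < m)%N -> D (x i) (y i) < m.+1%:R^-1) -> (`|g y - g x| : R) <= eta.
have := (compact_near_coveringP _).1 cP nat \oo Q _.
move=> /(_ _)[|m _ mQ]; last first.
  by exists m => x y Kx xy; exact: (mQ m (leqnn m) x Kx).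
move=> x Kx.
have eta2 : 0 < eta / 2 by rewrite divr_gt0.
have /cvgrPdist_lt/(_ _ eta2) := cg x.
move=> /nbhs_ptws[k [U [nU UP]]].
have /choice[r rP] : forall i, exists r : R, 0 < r /\ forall y, D (x i) y < r -> U i y.
  by move=> i; have [r r0 rU] := pullback_nbhs openS (nU i); exists r.
(* Two steps of size [dl] must fit into each radius, from [x] to [x'] and from [x'] to [y]; only [k]
   coordinates matter, so a positive minimum exists. *)
have [dl dl0 dlr] : exists2 dl : R, 0 < dl & forall i, (i < k)%N -> dl + dl <= r i.
  elim: k {UP} => [|k [dl dl0 dlr]]; first by exists 1.
  have [rk0 _] := rP k.
  exists (Num.min dl (r k / 2)); first by rewrite lt_min dl0 divr_gt0.
  move=> i; rewrite ltnS leq_eqVlt => /predU1P[->|ik].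
    by case: (leP dl (r k / 2)); lra.
  by have := dlr i ik; case: (leP dl (r k / 2)); lra.
have [n0 _ n0P] := near_infty_natSinv_lt (PosNum dl0).
exists ([set x' : {ptws nat -> S} | forall i : 'I_k, D (x i) (x' i) < dl],
        [set m | (maxn k n0 <= m)%N]); last first.
  move=> [x' m] /= [x'x]; rewrite geq_max => /andP[km n0m] y x'y.
  have U1 : `|g x - g x'| < eta / 2.
    apply: UP => i ik; apply: (rP i).2.
    have := x'x (Ordinal ik); have := dlr i ik; rewrite /=; lra.
  have U2 : `|g x - g y| < eta / 2.
    apply: UP => i ik; apply: (rP i).2.
    have := D_triangle (x i) (x' i) (y i).
    have : D (x' i) (y i) < dl := lt_trans (x'y i (leq_trans ik km)) (n0P m n0m).
    have := x'x (Ordinal ik); have := dlr i ik; rewrite /=; lra.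
  move: U1 U2; rewrite !ltr_norml ler_norml; lra.
split => /=; last by exists (maxn k n0).
have near_i (i : 'I_k) : nbhs x [set x' : {ptws nat -> S} | D (x i) (x' i) < dl].
  apply: (@ptws_proj_continuous S i x [set y | D (x i) y < dl]).
  exact: (nbhs_pullback openS).
exact: (@filter_forall _ _ _ (nbhs x) _ near_i).
Qed.

End PartitionOfUnity.

Lemma sum_halves_le (R : realType) (r : R) (m : nat) : 0 <= r ->
  \sum_(i < m) r / 2 ^+ i.+1 <= r.
Proof.
move=> r0; have E : \sum_(i < m) r / 2 ^+ i.+1 = r - r / 2 ^+ m.
  elim: m => [|m IHm]; first by rewrite big_ord0 expr0 divr1 subrr.
  by rewrite big_ord_recr/= IHm exprS; field; rewrite expf_neq0.
by rewrite E gerBl divr_ge0// exprn_ge0.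
Qed.

Section SequenceLaw.
Context (R : realType) (S : ptopologicalType) (T : metricType R) (e : S -> T)
  d (Omega : measurableType d) (P : probability Omega R)
  (X : nat -> {RV P >-> borelType S}).
Hypothesis openS : @open S = [set e @^-1` U | U in @open T].

Let D (x y : S) : R := mdist (e x) (e y).

Hypothesis cylinder_cvg : forall k (f : 'I_k -> S -> R), (forall i, continuous01 (f i)) ->
  cvgn (fun n => \int[P]_w (\prod_i f i (X (n + i)%N w))).

(** Tightness in a form that can be read off a limit law: the laws of the [X n] may give no mass to
    [K] itself, hence the test by continuous functions vanishing on [K]. *)
Hypothesis tight : forall r : R, 0 < r -> exists K : set S,
  [/\ compact K, K !=set0 & forall h : S -> R, continuous01 h ->
    (forall x, K x -> h x = 0) ->
    exists N : nat, forall n, (N <= n)%N -> \int[P]_w h (X n w) <= r].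

Definition shifted_sequence (n : nat) (w : Omega) : {ptws nat -> S} :=
  fun i => X (n + i)%N w.

Hypothesis shifted_measurable : forall n, measurable_fun setT
  (shifted_sequence n : Omega -> borelType {ptws nat -> S}).

Let bmY (g : {ptws nat -> S} -> R) n : continuous01 g ->
  bounded_measurable (fun w => g (shifted_sequence n w)).
Proof.
move=> cg.
exact: (bounded_measurable_comp (shifted_measurable n) (bounded_measurable_continuous01 cg)).
Qed.

Let bmX (h : S -> R) i : continuous01 h -> bounded_measurable (fun w => h (X i w)).
Proof. by move=> ch; exact: variable_bounded (bounded_measurable_continuous01 ch). Qed.

(** A finite combination [p] of products of partition functions, weighted by values of [g] at grid
    points, replaces [g]. The error is small near the product of the [K i], and elsewhere it is paid
    for by the defects [r i], whose means are eventually small. *)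
Lemma mean_sequence_cvg (g : {ptws nat -> S} -> R) : continuous01 g ->
  cvgn (fun n => \int[P]_w g (shifted_sequence n w)).
Proof.
move=> cg; apply: cauchy_cvg; apply: cauchy_exP => eps eps0.
have e8 : 0 < eps / 8 by rewrite divr_gt0.
(* The number [m] of relevant coordinates depends on the compact sets [K i], so these are chosen for
   all [i] beforehand, with summable tolerances. *)
have e8i i : 0 < eps / 8 / 2 ^+ i.+1 by rewrite divr_gt0// exprn_gt0.
have /choice[K KP] := fun i : nat => tight (e8i i).
have cK i : compact (K i) by have [] := KP i.
have nK i : K i !=set0 by have [] := KP i.
have [m gm] := product_uniform_continuity openS cK cg.1 e8.
have m0 : 0 < m.+1%:R^-1 :> R by rewrite invr_gt0 ltr0n.
have /choice[N0 HN0] := fun i => compact_partition_of_unity openS (cK i) (nK i) m0.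
have /choice[z Hz] := HN0.
have /choice[rho HP] := Hz.
have Kz i l : K i (z i l) by have [+ _ _ _ _] := HP i; apply.
have crho i l : continuous01 (rho i l) by have [_ + _ _ _] := HP i; apply.
have rhoD i l x : 0 < rho i l x -> D (z i l) x < m.+1%:R^-1 by have [_ _ + _ _] := HP i; apply.
pose N := (\max_(i < m) N0 i)%N.
pose r i x : R := 1 - \sum_(l < N) rho i l x.
have rho0 i l x : 0 <= rho i l x by have /andP[] := (crho i l).2 x.
have s01 i x : 0 <= \sum_(l < N) rho i l x <= 1.
  by rewrite sumr_ge0//=; have [_ _ _ + _] := HP i; apply.
have cr i : continuous01 (r i).
  apply: continuous01_compl; split; last exact: s01.
  by apply: continuous_bigsum => l _; exact: (crho i l).1.
have rK i x : (i < m)%N -> K i x -> r i x = 0.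
  move=> im Kx; apply/eqP; rewrite subr_eq0 eq_sym; apply/eqP.
  have [_ _ _ _ +] := HP i; apply => //.
  exact: (leq_bigmax (Ordinal im)).
have /choice[N1 N1P] : forall i : 'I_m, exists N1 : nat, forall n, (N1 <= n)%N ->
    \int[P]_w r i (X n w) <= eps / 8 / 2 ^+ i.+1.
  by move=> i; have [_ _] := KP i; apply => // x; exact: rK.
(* A grid point of the infinite product: beyond [m] any point of [K i] will do, since uniform
   continuity constrains only the first [m] coordinates. *)
pose zf (f : {ffun 'I_m -> 'I_N}) (i : nat) : S :=
  if insub i is Some j then z i (f j) else z i 0%N.
have Kzf f i : K i (zf f i) by rewrite /zf; case: insub.
pose pf (f : {ffun 'I_m -> 'I_N}) (y : {ptws nat -> S}) := \prod_(i < m) rho i (f i) (y i).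
pose p y := \sum_f g (zf f) * pf f y.
have pf0 f y : 0 <= pf f y by apply: prodr_ge0.
have spf y : \sum_f pf f y = \prod_(i < m) \sum_(l < N) rho i l (y i).
  by rewrite bigA_distr_bigA.
have g01 y : 0 <= g y <= 1 := cg.2 y.
have gpf y f : `|g y - g (zf f)| * pf f y <= eps / 8 * pf f y.
  have [/eqP ->|pfy] := boolP (pf f y == 0); first by rewrite !mulr0.
  apply: ler_wpM2r => //; apply: gm => // i im.
  rewrite /zf insubT/=; apply: rhoD; rewrite lt_neqAle rho0 andbT eq_sym.
  by move: pfy; rewrite /pf prodf_seq_neq0 => /allP/(_ (Ordinal im)); apply; exact: mem_index_enum.
have gp y : `|g y - p y| <= eps / 8 + \sum_(i < m) r i (y i).
  set q := \sum_f pf f y.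
  have q01 : 0 <= q <= 1.
    rewrite /q spf prodr_ge0/=; last by move=> i _; have /andP[] := s01 i (y i).
    by apply: Num.Theory.prodr_ile1 => i _; exact: s01.
  have qr : 1 - q <= \sum_(i < m) r i (y i).
    have := @dist_prod_le R m (fun=> 1) (fun i => \sum_(l < N) rho i l (y i)).
    rewrite big1// -spf -/q => /(_ _ _) h.
    apply: le_trans (ler_norm _) _; apply: le_trans (h _ _) _.
    - by move=> _; rewrite lexx ler01.
    - by move=> i; exact: s01.
    - by apply: ler_sum => i _; rewrite ger0_norm// subr_ge0; have /andP[] := s01 i (y i).
  have -> : g y - p y = g y * (1 - q) + \sum_f (g y - g (zf f)) * pf f y.
    have -> : \sum_f (g y - g (zf f)) * pf f y = g y * q - p y.
      by rewrite mulr_sumr -sumrB; apply: eq_bigr => f _; rewrite mulrBl.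
    by ring.
  apply: le_trans (ler_normD _ _) _; rewrite addrC; apply: lerD.
    apply: le_trans (ler_norm_sum _ _ _) _.
    apply: (@le_trans _ _ (\sum_f eps / 8 * pf f y)).
      by apply: ler_sum => f _; rewrite normrM (ger0_norm (pf0 f y)).
    by rewrite -mulr_sumr -/q; apply: ler_piMr; [exact: ltW|have /andP[] := q01].
  apply: le_trans _ qr; have /andP[g0 g1] := g01 y.
  have q1 : 0 <= 1 - q by rewrite subr_ge0; have /andP[] := q01.
  by rewrite ger0_norm ?mulr_ge0// ler_piMl.
have bpf f n : bounded_measurable (fun w => pf f (shifted_sequence n w)).
  by apply: bounded_measurable_prod => i _; exact: bmX.
have bgpf f n : bounded_measurable (fun w => g (zf f) * pf f (shifted_sequence n w)).
  by apply: bounded_measurableM => //; exact: bounded_measurable_cst.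
have bp n : bounded_measurable (fun w => p (shifted_sequence n w)).
  by apply: bounded_measurable_sum => f _; exact: bgpf.
have br n : bounded_measurable (fun w => \sum_(i < m) r i (X (n + i)%N w)).
  by apply: bounded_measurable_sum => i _; exact: bmX.
have cvp : cvgn (fun n => \int[P]_w p (shifted_sequence n w)).
  have E n : \int[P]_w p (shifted_sequence n w) =
      \sum_f g (zf f) * \int[P]_w pf f (shifted_sequence n w).
    rewrite mean_sum//; apply: eq_bigr => f _.
    by rewrite meanZ.
  under eq_fun do rewrite E.
  apply/cvg_ex; exists (\sum_f g (zf f) * limn (fun n => \int[P]_w pf f (shifted_sequence n w))).
  apply: cvg_big => [|f _]; first exact: add_continuous.
  apply: cvgM; first exact: cvg_cst.
  exact: (cylinder_cvg (fun i : 'I_m => crho i (f i))).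
have close n : (forall i, (N1 i <= n)%N) ->
    `|\int[P]_w g (shifted_sequence n w) - \int[P]_w p (shifted_sequence n w)| <= eps / 8 + eps / 8.
  move=> nN1; rewrite -meanB//; last exact: bmY.
  have bgp := bounded_measurableB (bmY n cg) (bp n).
  apply: le_trans (norm_mean_le _ bgp) _.
  apply: (@le_trans _ _ (\int[P]_w (eps / 8 + \sum_(i < m) r i (X (n + i)%N w)))).
    apply: le_mean.
    - exact: bounded_measurable_norm.
    - by apply: bounded_measurableD => //; exact: bounded_measurable_cst.
    - by move=> w; exact: gp.
  rewrite meanD//; last exact: bounded_measurable_cst.
  rewrite mean_cst lerD2l mean_sum; last first.
    by move=> i _; exact: bmX.
  apply: le_trans (sum_halves_le m (ltW e8)).
  by apply: ler_sum => i _; apply: N1P; rewrite (leq_trans (nN1 i))// leq_addr.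
(* At each of the two times [g] is replaced by [p] at cost [2 * eps / 8] and [p] by its limit at
   cost [eps / 8]: in all [6 * eps / 8], below [eps]. *)
have /cvgrPdist_le/(_ _ e8)[N2 _ N2P] := cvp.
pose n0 := maxn N2 (\max_i N1 i)%N.
exists (\int[P]_w g (shifted_sequence n0 w)), n0 => // n /= n0n.
rewrite /ball/=.
have n0N1 i : (N1 i <= n0)%N by rewrite (leq_trans _ (leq_maxr _ _))//; exact: leq_bigmax.
have := close n0 n0N1; have := close n (fun i => leq_trans (n0N1 i) n0n).
have := N2P n0 (leq_maxl _ _); have := N2P n (leq_trans (leq_maxl _ _) n0n).
rewrite /= !ler_norml ltr_norml; lra.
Qed.

End SequenceLaw.

(** * Exchangeability *)

Section BoxUniqueness.
Context (R : realType) (S : ptopologicalType) (n : nat).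

Let boxes : set (set (n.-tuple (borelType S))) :=
  [set [set t | forall i, G i (tnth t i)] | G in [set G : 'I_n -> set S | forall i, open (G i)]].

Lemma measurable_tuple_open_boxes :
  @measurable _ (n.-tuple (borelType S)) = <<s boxes >>.
Proof.
rewrite eqEsubset; split.
  apply: smallest_sub; first exact: smallest_sigma_algebra.
  rewrite -bigcup_seq => _ [i _ [A mA <-]]; rewrite setTI.
  pose M := [set A : set (borelType S) | <<s boxes >> ((fun t : n.-tuple S => tnth t i) @^-1` A)].
  suff : @measurable _ (borelType S) `<=` M by apply.
  have sM : sigma_algebra setT M.
    split.
    - by rewrite /M /= preimage_set0; exact: sigma_algebra0.
    - move=> B MB; rewrite /M /= setTD preimage_setC.
      exact: (@sigma_algebraC (n.-tuple (borelType S))).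
    - move=> F MF; rewrite /M /= preimage_bigcup.
      exact: (@sigma_algebra_bigcup _ setT boxes).
  apply: smallest_sub => // U oU; apply: sub_sigma_algebra.
  exists (fun j => if j == i then U else setT).
    by move=> j /=; case: ifP => // _; exact: openT.
  apply/seteqP; split => t /=; first by move=> /(_ i); rewrite eqxx.
  by move=> Ut j; case: eqP => [->|].
apply: smallest_sub; first exact: sigma_algebra_measurable.
move=> _ [G oG <-].
rewrite (_ : [set t | _] = \bigcap_(i in setT) ((fun t : n.-tuple (borelType S) => tnth t i) @^-1` G i)).
  apply: fin_bigcap_measurable => // i _; rewrite -[X in measurable X]setTI.
  by apply: measurable_tnth => //; apply: sub_sigma_algebra; exact: oG.
by apply/seteqP; split => t /= h i //; [move=> _|]; exact: h.
Qed.

Lemma tuple_law_unique (m1 m2 : probability (n.-tuple (borelType S)) R) :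
  (forall G : 'I_n -> set S, (forall i, open (G i)) ->
    m1 [set t | forall i, G i (tnth t i)] = m2 [set t | forall i, G i (tnth t i)]) ->
  forall C, measurable C -> m1 C = m2 C.
Proof.
move=> m12 C mC.
apply: (measure_unique boxes (fun=> setT)) => //.
- exact: measurable_tuple_open_boxes.
- move=> _ _ [G oG <-] [H oH <-]; exists (fun i => G i `&` H i).
    by move=> i; apply: openI; [exact: oG|exact: oH].
  apply/seteqP; split => t /=; first by move=> GH; split => i; have [] := GH i.
  by move=> [Gt Ht] i; split; [exact: Gt|exact: Ht].
- move=> _; exists (fun=> setT); first by move=> i; exact: openT.
  by apply/seteqP.
- by rewrite bigcup_const//; exists 0%N.
- by move=> _ [G oG <-]; exact: m12.
- by move=> _; rewrite ltey_eq fin_num_measure.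
Qed.

End BoxUniqueness.

Section Limit.
Context (R : realType) (S : ptopologicalType) (d : measure_display)
  (Omega : measurableType d) (P : probability Omega R)
  (X : nat -> {RV P >-> borelType S}).

Let V : ptopologicalType := {ptws nat -> S}.

Lemma measurable_coordinate i :
  measurable_fun setT ((fun x => x i) : borelType V -> borelType S).
Proof.
apply: (@measurability _ _ (borelType V) (borelType S) setT _ (@open S)) => //.
move=> _ [U oU <-]; rewrite setTI; apply: sub_sigma_algebra.
apply: (@open_comp _ _ (fun x : {ptws nat -> S} => x i)) => //.
by move=> x _; exact: ptws_proj_continuous.
Qed.

Variable nu : probability (borelType V) R.

Definition coordinate (i : nat) (x : borelType V) : borelType S := x i.

HB.instance Definition _ i := isMeasurableFun.Build _ _ (borelType V) (borelType S)
  (coordinate i) (measurable_coordinate i).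

Definition coordinate_variable (i : nat) : {RV nu >-> borelType S} := coordinate i.

Definition coordinate_tuple (n : nat) (s : 'S_n) (x : borelType V) :
  n.-tuple (borelType S) := [tuple x (s i) | i < n].

Lemma measurable_coordinate_tuple n (s : 'S_n) :
  measurable_fun setT (coordinate_tuple s).
Proof.
apply/measurable_fun_tnthP => i.
apply: eq_measurable_fun (measurable_coordinate (s i)) => x _.
by rewrite /= tnth_mktuple.
Qed.

HB.instance Definition _ n (s : 'S_n) := isMeasurableFun.Build _ _ (borelType V)
  (n.-tuple (borelType S)) (coordinate_tuple s) (measurable_coordinate_tuple s).

Hypothesis S_exh : open_exhaustible R S.

(* Indicators of open boxes are limits of products of continuous functions. *)
Lemma exchangeable_coordinates :
  (forall n (f : 'I_n -> S -> R), (forall i, continuous01 (f i)) -> forall s : 'S_n,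
    \int[nu]_x (\prod_i f i (x (s i))) = \int[nu]_x (\prod_i f i (x i))) ->
  exchangeable coordinate_variable.
Proof.
move=> exch n s C mC.
(* With the identity permutation the unpermuted tuple takes the same form as the permuted one, and
   [limit] below treats both. *)
have E : coordinate_tuple (1%g : 'S_n) = fun x => [tuple coordinate_variable i x | i < n].
  by apply/funext => x; apply: eq_from_tnth => i; rewrite !tnth_mktuple perm1.
rewrite -[RHS]/(nu ((fun x => [tuple coordinate_variable i x | i < n]) @^-1` C)) -E.
apply: (tuple_law_unique (m1 := distribution nu (coordinate_tuple s))
  (m2 := distribution nu (coordinate_tuple (1%g : 'S_n)))) => // G oG.
have /choice[h hP] := fun i => S_exh (oG i).
have ch i k : continuous01 (h i k) by have [+ _ _ _] := hP i.
have limit (t : 'S_n) : \int[nu]_x (\prod_i h i k (x (t i))) @[k --> \oo] -->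
    fine (distribution nu (coordinate_tuple t) [set u | forall i, G i (tnth u i)]).
  pose B := [set x : borelType V | forall i, G i (x (t i))].
  have EB : distribution nu (coordinate_tuple t) [set u | forall i, G i (tnth u i)] = nu B.
    rewrite /distribution /pushforward; congr (nu _); apply/seteqP.
    by split => x /= + i => /(_ i); rewrite tnth_mktuple.
  have mB : measurable B.
    rewrite (_ : B = \bigcap_(i in setT) ((fun x : borelType V => x (t i)) @^-1` G i)).
      apply: fin_bigcap_measurable => // i _; rewrite -[X in measurable X]setTI.
      by apply: measurable_coordinate => //; apply: sub_sigma_algebra; exact: oG.
    by apply/seteqP; split => x /= Bx i //; [move=> _|]; exact: Bx.
  rewrite EB -mean_indic//.
  apply: (@mean_cvg _ _ _ nu _ _ 1).
  - move=> k; have [] // : bounded_measurable (fun x : borelType V => \prod_i h i k (x (t i))).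
    apply: bounded_measurable_prod => i _.
    exact: (bounded_measurable_comp (measurable_coordinate (t i))
      (bounded_measurable_continuous01 (ch i k))).
  - move=> k x; rewrite ger0_norm; last first.
      by apply: prodr_ge0 => i _; have /andP[] := (ch i k).2 (x (t i)).
    by apply: Num.Theory.prodr_ile1 => i _; exact: (ch i k).2.
  - move=> x; rewrite indicE; have [Bx|nBx] := pselect (B x); last first.
      rewrite memNset//=; apply: cvg_near_cst; apply: nearW => k.
      have /existsNP[i nGi] := nBx.
      by rewrite (bigD1 i)//=; have [_ _ -> //] := hP i; rewrite mul0r.
    rewrite mem_set//=.
    have /choice[N NP] : forall i, exists N, h i N (x (t i)) = 1.
      by move=> i; have [_ _ _ +] := hP i; apply; exact: Bx.
    apply: cvg_near_cst; exists (\max_i N i)%N => // k /= Nk.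
    rewrite big1// => i _; apply/eqP; rewrite eq_le; have /andP[_ ->] := (ch i k).2 (x (t i)).
    rewrite -(NP i); have [_ mh _ _] := hP i; apply: mh.
    by apply: leq_trans Nk; exact: leq_bigmax.
have E1 k : \int[nu]_x (\prod_i h i k (x (s i))) =
    \int[nu]_x (\prod_i h i k (x ((1%g : 'S_n) i))).
  have e := exch n (fun i => h i k) (fun i => ch i k).
  exact: etrans (e s) (esym (e 1%g)).
rewrite -[LHS]fineK ?fin_num_measure//; last first.
  by rewrite measurable_tuple_open_boxes; apply: sub_sigma_algebra; exists G.
rewrite -[RHS]fineK ?fin_num_measure//; last first.
  by rewrite measurable_tuple_open_boxes; apply: sub_sigma_algebra; exists G.
congr (_%:E); apply: cvg_unique (limit s) _ => //.
by rewrite /= (funext E1); exact: limit.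
Qed.

End Limit.

(** * Tightness of the marginals, and the limit law of the shifted sequence *)

Section LimitLaw.
Context (R : realType) (S : ptopologicalType) d (Omega : measurableType d)
  (P : probability Omega R) (X : nat -> {RV P >-> borelType S}).
Hypothesis cylinder_cvg : forall k (f : 'I_k -> S -> R), (forall i, continuous01 (f i)) ->
  cvgn (fun n => \int[P]_w (\prod_i f i (X (n + i)%N w))).

(** Cylinders with one factor give a limit law of the [X n] on [S]. A compact set carrying most of
    that one law bounds the limiting mean of any [h] that vanishes on it. *)
Lemma marginal_tight (T : metricType R) (e : S -> T) : polish_metric T ->
  @open S = [set e @^-1` U | U in @open T] -> <<s @open T >> (range e) ->
  forall r : R, 0 < r -> exists K : set S,
  [/\ compact K, K !=set0 & forall h : S -> R, continuous01 h ->
    (forall x, K x -> h x = 0) ->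
    exists N : nat, forall n, (N <= n)%N -> \int[P]_w h (X n w) <= r].
Proof.
move=> Tp openS rangeE r r0.
have [phi baseS] := pullback_base Tp openS.
have lawE h n : continuous01 h -> \int[distribution P (X n)]_x h x = \int[P]_w h (X n w).
  by move=> ch; rewrite mean_distribution//; exact: bounded_measurable_continuous01.
have law_cvg (h : S -> R) : continuous01 h -> cvgn (fun n => \int[distribution P (X n)]_x h x).
  move=> ch; under eq_fun do rewrite lawE//.
  have := cylinder_cvg (fun _ : 'I_1 => ch).
  rewrite (_ : (fun n => _) = fun n => \int[P]_w h (X n w))//.
  by apply/funext => n; apply: eq_Rintegral => w _; rewrite big_ord1 addn0.
have [mu muP] := weak_limit_exists law_cvg (countable_base01_exhaustible baseS).
(* [r / 2] leaves room for the convergence of the means; [1 / 2] prevents [K] from being empty. *)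
pose c := Num.min (r / 2) (1 / 2).
have c0 : 0 < c by rewrite lt_min !divr_gt0.
have [K [cK mK muK]] := pullback_tight Tp openS rangeE mu c0.
exists K; split => //.
  apply/set0P/eqP => K0; move: muK; rewrite K0 setC0 probability_setT lee_fin.
  by rewrite le_min => /andP[_]; lra.
move=> h ch hK.
have mh : \int[mu]_x h x <= r / 2.
  apply: (@le_trans _ _ (\int[mu]_x \1_(~` K) x)).
    apply: le_mean; first exact: bounded_measurable_continuous01.
      by apply: bounded_measurable_indic; exact: measurableC.
    move=> x; rewrite indicE; have [Kx|nKx] := pselect (K x).
      by rewrite hK// ler0n.
    by rewrite mem_set//=; have /andP[] := ch.2 x.
  rewrite mean_indic; last exact: measurableC.
  rewrite -lee_fin fineK ?fin_num_measure//; last exact: measurableC.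
  by apply: le_trans muK _; rewrite lee_fin ge_min lexx.
have r2 : 0 < r / 2 by rewrite divr_gt0.
have /cvgrPdist_le/(_ _ r2)[N _ NP] := muP h ch.
exists N => n Nn; have := NP n Nn; rewrite lawE// ler_norml; lra.
Qed.

Lemma shifted_sequence_measurable (phi : nat -> S -> R) : countable_base01 phi ->
  forall n, measurable_fun setT
    (shifted_sequence X n : Omega -> borelType {ptws nat -> S}).
Proof.
move=> baseS n.
apply: (@measurable_countable_base01 R {ptws nat -> S} _ _ _ _ (cylinder_base01 baseS)) => m.
rewrite /cylinder_base; case: (choice.unpickle m) => [s|]; last exact: measurable_cst.
have [] // : bounded_measurable (fun w =>
  \prod_(i < size s) phi (nth 0%N s i) (shifted_sequence X n w i)).
apply: bounded_measurable_prod => i _.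
exact: variable_bounded (bounded_measurable_continuous01 (baseS.1 _)).
Qed.

End LimitLaw.

Theorem theorem2 (R : realType) (S : ptopologicalType)
    (d : measure_display) (Omega : measurableType d)
    (P : probability Omega R) (X : nat -> {RV P >-> borelType S})
    (alpha : nat -> R.-pker Omega ~> borelType S) :
  standard_borel R S ->
  (forall n, is_predictive X n (alpha n)) ->
  (forall f : S -> R, continuous f -> bounded_fun f ->
     cvg_in_probability P (fun n w => \int[alpha n w]_x f x)) ->
  asymptotically_exchangeable X.
Proof.
move=> [T [e [Tp _ openS rangeE]]] alphaP alpha_cvg.
have cyl := cylinder_limit alphaP alpha_cvg.
have cylinder_cvg k (f : 'I_k -> S -> R) : (forall i, continuous01 (f i)) ->
    cvgn (fun n => \int[P]_w (\prod_i f i (X (n + i)%N w))).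
  move=> cf; have [l lP] := cyl k f cf; apply/cvg_ex; exists l.
  rewrite (_ : (fun n => _) = fun n => \int[P]_w (\prod_i f i (X (n + (1%g : 'S_k) i)%N w)))//.
  apply/funext => n; apply: eq_Rintegral => w _; apply: eq_bigr => i _.
  by rewrite perm1.
have [phi baseS] := pullback_base Tp openS.
have mY := shifted_sequence_measurable X baseS.
have tight := marginal_tight cylinder_cvg Tp openS rangeE.
have seq_cvg := mean_sequence_cvg openS cylinder_cvg tight mY.
pose Y n : {RV P >-> borelType {ptws nat -> S}} :=
  HB.pack (shifted_sequence X n : Omega -> borelType {ptws nat -> S})
    (isMeasurableFun.Build _ _ Omega (borelType {ptws nat -> S}) _ (mY n)).
have lawE (h : {ptws nat -> S} -> R) n : continuous01 h ->
    \int[distribution P (Y n)]_x h x = \int[P]_w h (shifted_sequence X n w).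
  by move=> ch; rewrite mean_distribution//; exact: bounded_measurable_continuous01.
have law_cvg (h : {ptws nat -> S} -> R) : continuous01 h ->
    cvgn (fun n => \int[distribution P (Y n)]_x h x).
  by move=> ch; under eq_fun do rewrite lawE//; exact: seq_cvg.
have [nu nuP] := weak_limit_exists law_cvg
  (countable_base01_exhaustible (cylinder_base01 baseS)).
have nuY (h : {ptws nat -> S} -> R) : continuous01 h ->
    \int[P]_w h (shifted_sequence X n w) @[n --> \oo] --> \int[nu]_x h x.
  by move=> ch; have := nuP h ch; under eq_fun do rewrite lawE//.
exists _, (borelType {ptws nat -> S}), nu, (coordinate_variable nu); split.
  apply: (exchangeable_coordinates (countable_base01_exhaustible baseS)).
  move=> n f cf s; have [l lP] := cyl n f cf.
  (* The product is itself a continuous function of the sequence, so the convergence to [nu] and the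
     cylinder limit describe the same sequence of means; their limits agree for every [t]. *)
  have nul (t : 'S_n) : \int[nu]_x (\prod_i f i (x (t i))) = l.
    apply: cvg_unique (lP t) => //=.
    apply: (nuY (fun x : {ptws nat -> S} => \prod_i f i (x (t i)))); split => x.
      apply: continuous_bigprod => i _ y.
      apply: (@continuous_comp _ _ _ (fun y : {ptws nat -> S} => y (t i))).
        exact: ptws_proj_continuous.
      exact: (cf i).1.
    rewrite prodr_ge0/=; last by move=> i _; have /andP[] := (cf i).2 (x (t i)).
    by apply: Num.Theory.prodr_ile1 => i _; exact: (cf i).2.
  rewrite nul -(nul (1%g : 'S_n)); apply: eq_Rintegral => x _.
  by apply: eq_bigr => i _; rewrite perm1.
move=> g cg [M0 [_ gM0]].
(* Strictly above [M0], as the definition of boundedness requires, and positive, so that [u] below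
   can rescale [g] into [0, 1]. *)
pose M := Num.max M0 0 + 1.
have M_gt0 : 0 < M by rewrite ltr_wpDl// le_max lexx orbT.
have gM x : `|g x| <= M.
  by apply: (gM0 M) => //; rewrite /M ltr_pwDr// le_max lexx.
pose u x := (g x + M) / (2 * M).
have cu : continuous01 u.
  split => x.
    apply: cvgM; last exact: cvg_cst.
    by apply: cvgD; [exact: cg|exact: cvg_cst].
  have := gM x; rewrite ler_norml => /andP[Mg gM'].
  have M2 : 0 < 2 * M by rewrite mulr_gt0.
  by rewrite /u ler_pdivrMr// mul1r divr_ge0 ?(ltW M2)//=; lra.
have gu x : g x = (2 * M) * u x - M by rewrite /u; field; rewrite gt_eqF.
have bu n : bounded_measurable (fun w => u (shifted_sequence X n w)).
  exact: (bounded_measurable_comp (mY n) (bounded_measurable_continuous01 cu)).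
have bg n : bounded_measurable (fun w => g (shifted_sequence X n w)).
  exact: (bounded_measurable_comp (mY n) (bounded_measurable_continuous cg gM)).
have bnu : bounded_measurable (g : borelType {ptws nat -> S} -> R).
  exact: bounded_measurable_continuous cg gM.
have EP n : 'E_P[g \o (fun w i => X (n + i)%N w)]%E =
    (\int[P]_w g (shifted_sequence X n w))%:E.
  by rewrite unlock EFin_mean.
have EQ : 'E_nu[g \o (fun w i => coordinate_variable nu i w)]%E = (\int[nu]_x g x)%:E.
  by rewrite unlock EFin_mean.
rewrite EQ; under eq_fun do rewrite EP.
apply: cvg_EFin; first exact: nearW.
have -> : \int[nu]_x g x = (2 * M) * \int[nu]_x u x - M.
  have b1 : bounded_measurable (u : borelType {ptws nat -> S} -> R).
    exact: bounded_measurable_continuous01.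
  rewrite -meanZ// -[X in _ - X](mean_cst nu M) -meanB//.
  - by apply: eq_Rintegral => x _; exact: gu.
  - by apply: bounded_measurableM => //; exact: bounded_measurable_cst.
  - exact: bounded_measurable_cst.
have Eg n : \int[P]_w g (shifted_sequence X n w) =
    (2 * M) * \int[P]_w u (shifted_sequence X n w) - M.
  rewrite -meanZ// -[X in _ - X](mean_cst P M) -meanB//.
  - by apply: eq_Rintegral => x _; exact: gu.
  - by apply: bounded_measurableM => //; exact: bounded_measurable_cst.
  - exact: bounded_measurable_cst.
rewrite (_ : fine \o _ = fun n => (2 * M) * \int[P]_w u (shifted_sequence X n w) - M); last first.
  by apply/funext => n /=; rewrite Eg.
apply: cvgB; last exact: cvg_cst.
by apply: cvgM; [exact: cvg_cst|exact: nuY].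
Qed.
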